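(* Let $p\colon\mathbb{E}\to\mathbb{B}$ be a fibration with all finite limits (each fibre has finite limits and reindexing preserves them). Let $(L_1,R_1)$ be an lawfs over $\mathbb{B}$. Write $U\colon R_1\text{-Alg}\to V(\mathbb{E})$ for the forgetful functor. Suppose we are given an initial object of $(f\downarrow U_Y)$ for every object $Y$ of $\mathbb{E}$ and every vertical map $f\colon X\to Y$. Then there exists an algebraically free awfs on $(L_1,R_1)$.
   Context: Fibrations. $p$ is cloven. Vertical maps are those sent by $p$ to identities. $V(\mathbb{E})$ is the full subcategory of $\mathbb{E}^{\mathbf 2}$ on vertical maps, with $\mathrm{dom},\mathrm{cod}\colon V(\mathbb{E})\to\mathbb{E}$. A functor, (co)pointed endofunctor or (co)monad on $V(\mathbb{E})$ is ''over $\mathrm{cod}$'' (resp. $\mathrm{dom}$) if it commutes strictly with $\mathrm{cod}$ (resp. $\mathrm{dom}$) and its structural natural transformations have identity codomain (resp. domain) components. Factorisations. A functorial factorisation over $\mathbb{B}$ functorially factors each vertical $f\colon X\to Y$ as $X\xrightarrow{Lf}Kf\xrightarrow{Rf}Y$ with both maps vertical (over $\mathbb{B}$). Then $R$ is a pointed endofunctor over $\mathrm{cod}$ with unit $\lambda_f=(Lf,1_Y)\colon f\to Rf$ and $L$ is a copointed endofunctor over $\mathrm{dom}$ with counit $\rho_f=(1_X,Rf)\colon Lf\to f$. An lawfs is a functorial factorisation with $\Sigma\colon L\Rightarrow L^2$ making $L$ a comonad over $\mathrm{dom}$. An awfs is a functorial factorisation with such a $\Sigma$ and with $\Pi\colon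 R^2\Rightarrow R$ making $R$ a monad over $\mathrm{cod}$, such that the canonical natural transformation $LR\Rightarrow RL$ is a distributive law; its component at $f$ is the square $LRf\to RLf$ with domain component $\delta_f\colon Kf\to KLf$ (the codomain component of $\Sigma_f$) and codomain component $\pi_f\colon KRf\to Kf$ (the domain component of $\Pi_f$). Algebras. For a pointed endofunctor, $(R,\lambda)\text{-Alg}$ (written $R_1\text{-Alg}$ for the underlying pointed endofunctor of $(L_1,R_1)$) has objects $(g,\alpha\colon Rg\to g)$ with $\alpha\circ\lambda_g=1$. For a monad, $(R,\lambda,\Pi)\text{-Alg}$ is the category of monad algebras. $U_Y$ is the restriction of $U$ to fibres over $Y$ of the functors to $\mathbb{E}$ given by $\mathrm{cod}$: $V(\mathbb{E})_Y$ consists of vertical maps with codomain $Y$ and morphisms with identity codomain component. So an object of the comma category $(f\downarrow U_Y)$ is an $R_1$-algebra $(g,\alpha)$ with $\mathrm{cod}\,g=Y$ and a morphism $f\to g$ in $V(\mathbb{E})_Y$. Algebraically free. A morphism of functorial factorisations is a natural transformation between the corresponding factorisation functors, with identity components at the domain and codomain of each $f$, so given by vertical maps $Kf\to K'f$; it is a morphism of lawfs's if it respects comultiplication. It induces a functor $(R',\lambda')\text{-Alg}\to(R,\lambda)\text{-Alg}$. An algebraically free awfs on an lawfs $(L,R,\Sigma)$ is an awfs $(L',R',\Sigma',\Pi')$ with a morphism of lawfs's $(L,R,\Sigma)\to(L',R',\Sigma')$ such that the composite $(R',\lambda',\Pi')\text{-Alg}\to(R',\lambda')\text{-Alg}\to(R,\lambda)\text{-Alg}$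 (forgetful functor followed by the induced functor) is an isomorphism. *)

(* Defs.v *)
(* Morphisms are compared by Leibniz equality, and the strict notions (lying
   over an arrow, vertical map, fibre, isomorphism of categories) are kept
   strict, with equality of objects. *)
From Stdlib Require Import ClassicalEpsilon FinFun.

Set Implicit Arguments.
Unset Strict Implicit.
Set Primitive Projections.
#[local] Obligation Tactic := idtac.

Declare Scope cat_scope.
Delimit Scope cat_scope with cat.
Open Scope cat_scope.

Record Category := {
  ob :> Type;
  hom : ob -> ob -> Type;
  idm : forall a, hom a a;
  cmp : forall a b c, hom b c -> hom a b -> hom a c;
  cmp_idl : forall a b (f : hom a b), cmp (idm b) f = f;
  cmp_idr : forall a b (f : hom a b), cmp f (idm a) = f;
  cmp_assoc : forall a b c d (h : hom c d) (g : hom b c) (f : hom a b),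
    cmp h (cmp g f) = cmp (cmp h g) f
}.
Arguments hom {_} _ _.
Arguments idm {_} _.
Arguments cmp {_ _ _ _} _ _.
Notation "g ∘ f" := (cmp g f) (at level 40, left associativity) : cat_scope.

Record Functor (C D : Category) := {
  fob :> C -> D;
  fmap : forall a b, hom a b -> hom (fob a) (fob b);
  fmap_id : forall a, fmap (idm a) = idm (fob a);
  fmap_cmp : forall a b c (g : hom b c) (f : hom a b),
    fmap (g ∘ f) = fmap g ∘ fmap f
}.
Arguments fmap {_ _} _ {_ _} _.

Program Definition id_functor (C : Category) : Functor C C :=
  {| fob := fun a => a; fmap := fun _ _ f => f |}.
Next Obligation. reflexivity. Qed.
Next Obligation. reflexivity. Qed.

Program Definition comp_functor (C D E : Category)
    (G : Functor D E) (F : Functor C D) : Functor C E :=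
  {| fob := fun a => G (F a); fmap := fun _ _ f => fmap G (fmap F f) |}.
Next Obligation. intros; cbn; now rewrite !fmap_id. Qed.
Next Obligation. intros; cbn; now rewrite !fmap_cmp. Qed.
Notation "G ⊚ F" := (comp_functor G F) (at level 40, left associativity)
  : cat_scope.

Definition is_iso_functor (C D : Category) (F : Functor C D) : Prop :=
  exists G : Functor D C, G ⊚ F = id_functor C /\ F ⊚ G = id_functor D.

Record NatTrans (C D : Category) (F G : Functor C D) := {
  nt :> forall a, hom (F a) (G a);
  nt_nat : forall a b (f : hom a b), nt b ∘ fmap F f = fmap G f ∘ nt a
}.

(* Equality of arrows whose endpoints are only propositionally equal. *)
Inductive arr_eq (C : Category) (a b : C) (f : hom a b) :
    forall a' b' : C, hom a' b' -> Prop :=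
  arr_eq_refl : arr_eq f f.

Lemma arr_eq_cast (C : Category) (a b a' b' : C) (f : hom a b)
    (f' : hom a' b') (H : arr_eq f f') :
  exists (ea : a = a') (eb : b = b'),
    f' = eq_rect b (fun y => hom a' y) (eq_rect a (fun x => hom x b) f a' ea)
           b' eb.
Proof. destruct H. now exists eq_refl, eq_refl. Qed.

Lemma arr_eq_eq (C : Category) (a b : C) (f f' : hom a b) :
  arr_eq f f' -> f = f'.
Proof.
  intros H; destruct (arr_eq_cast H) as (ea & eb & ->).
  now rewrite (proof_irrelevance _ ea eq_refl), (proof_irrelevance _ eb eq_refl).
Qed.

Lemma arr_eq_sym (C : Category) (a b a' b' : C) (f : hom a b)
    (f' : hom a' b') : arr_eq f f' -> arr_eq f' f.
Proof. intros []; constructor. Qed.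

Lemma arr_eq_trans (C : Category) (a b a' b' a'' b'' : C) (f : hom a b)
    (f' : hom a' b') (f'' : hom a'' b'') :
  arr_eq f f' -> arr_eq f' f'' -> arr_eq f f''.
Proof. intros [] H; exact H. Qed.

Lemma arr_eq_cmp (C : Category) (a b c a' b' c' : C)
    (f : hom a b) (g : hom b c) (f' : hom a' b') (g' : hom b' c') :
  arr_eq f f' -> arr_eq g g' -> arr_eq (g ∘ f) (g' ∘ f').
Proof.
  intros Hf Hg.
  destruct (arr_eq_cast Hf) as (ea & eb & ->).
  destruct (arr_eq_cast Hg) as (eb' & ec & ->).
  destruct ea, eb, ec.
  rewrite (proof_irrelevance _ eb' eq_refl). constructor.
Qed.

Lemma arr_eq_fmap (C D : Category) (F : Functor C D) (a b a' b' : C)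
    (f : hom a b) (f' : hom a' b') :
  arr_eq f f' -> arr_eq (fmap F f) (fmap F f').
Proof. intros []; constructor. Qed.

Lemma arr_eq_idm (C : Category) (a b : C) : a = b -> arr_eq (idm a) (idm b).
Proof. intros []; constructor. Qed.

Lemma arr_eq_exists_id (C : Category) (a b d : C) :
  a = d -> b = d -> exists w : hom a b, arr_eq w (idm d).
Proof. intros -> ->; exists (idm d); constructor. Qed.

Record FullSubOb (C : Category) (P : C -> Prop) := {
  fs_ob :> C;
  fs_prop : P fs_ob
}.

Program Definition FullSub (C : Category) (P : C -> Prop) : Category :=
  {| ob := FullSubOb P;
     hom := fun x y => @hom C x y;
     idm := fun x => @idm C x;
     cmp := fun x y z g f => @cmp C x y z g f |}.
Next Obligation. intros; apply cmp_idl. Qed.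
Next Obligation. intros; apply cmp_idr. Qed.
Next Obligation. intros; apply cmp_assoc. Qed.

Program Definition fs_inclusion (C : Category) (P : C -> Prop) :
    Functor (FullSub P) C :=
  {| fob := fun x : FullSub P => fs_ob x; fmap := fun _ _ f => f |}.
Next Obligation. reflexivity. Qed.
Next Obligation. reflexivity. Qed.

Record ArrOb (C : Category) := {
  adom : C;
  acod : C;
  arr : hom adom acod
}.

Record ArrHom (C : Category) (f g : ArrOb C) := {
  hdom : hom (adom f) (adom g);
  hcod : hom (acod f) (acod g);
  hsq : hcod ∘ arr f = arr g ∘ hdom
}.

Lemma ArrHom_eq (C : Category) (f g : ArrOb C) (s t : ArrHom f g) :
  hdom s = hdom t -> hcod s = hcod t -> s = t.
Proof.
  destruct s as [s1 s2 s3], t as [t1 t2 t3]; cbn; intros <- <-.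
  now rewrite (proof_irrelevance _ s3 t3).
Qed.

Program Definition Arr (C : Category) : Category :=
  {| ob := ArrOb C;
     hom := @ArrHom C;
     idm := fun f => {| hdom := idm (adom f); hcod := idm (acod f) |};
     cmp := fun f g h t s =>
       {| hdom := hdom t ∘ hdom s; hcod := hcod t ∘ hcod s |} |}.
Next Obligation. intros; cbn; now rewrite cmp_idl, cmp_idr. Qed.
Next Obligation.
  intros; cbn; now rewrite <- cmp_assoc, hsq, cmp_assoc, hsq, cmp_assoc.
Qed.
Next Obligation. intros; apply ArrHom_eq; apply cmp_idl. Qed.
Next Obligation. intros; apply ArrHom_eq; apply cmp_idr. Qed.
Next Obligation. intros; apply ArrHom_eq; apply cmp_assoc. Qed.

Record FibOb (C D : Category) (F : Functor C D) (d : D) := {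
  fib_ob :> C;
  fib_eq : F fib_ob = d
}.

Record FibHom (C D : Category) (F : Functor C D) (d : D) (x y : FibOb F d) := {
  fib_hom :> @hom C x y;
  fib_hom_id : arr_eq (fmap F fib_hom) (idm d)
}.

Lemma FibHom_eq (C D : Category) (F : Functor C D) (d : D) (x y : FibOb F d)
    (f g : FibHom x y) : fib_hom f = fib_hom g -> f = g.
Proof.
  destruct f as [f Hf], g as [g Hg]; cbn; intros <-.
  now rewrite (proof_irrelevance _ Hf Hg).
Qed.

(* Used for the fibres of a fibration [p], for the fibres V(E)_Y of the
   codomain functor and for the fibres of algebras over [E]. *)
Program Definition Fib (C D : Category) (F : Functor C D) (d : D) : Category :=
  {| ob := FibOb F d;
     hom := @FibHom C D F d;
     idm := fun x => {| fib_hom := idm (fib_ob x) |};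
     cmp := fun x y z g f => {| fib_hom := fib_hom g ∘ fib_hom f |} |}.
Next Obligation. intros; cbn; rewrite fmap_id; apply arr_eq_idm, fib_eq. Qed.
Next Obligation.
  intros; cbn; rewrite fmap_cmp, <- (cmp_idl (idm d)).
  apply arr_eq_cmp; apply fib_hom_id.
Qed.
Next Obligation. intros; apply FibHom_eq; apply cmp_idl. Qed.
Next Obligation. intros; apply FibHom_eq; apply cmp_idr. Qed.
Next Obligation. intros; apply FibHom_eq; apply cmp_assoc. Qed.

(* Restriction of [U], viewed as a functor over the base [D] of [F],
   to the fibres over [d]. *)
Program Definition fib_restrict (A C D : Category) (U : Functor A C)
    (F : Functor C D) (d : D) : Functor (Fib (F ⊚ U) d) (Fib F d) :=
  {| fob := fun x : Fib (F ⊚ U) d =>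
       {| fib_ob := U (fib_ob x); fib_eq := fib_eq x |} : Fib F d;
     fmap := fun x y f =>
       {| fib_hom := fmap U (fib_hom f); fib_hom_id := fib_hom_id f |} |}.
Next Obligation. intros; apply FibHom_eq; apply fmap_id. Qed.
Next Obligation. intros; apply FibHom_eq; apply fmap_cmp. Qed.

Record CommaOb (A C : Category) (x : C) (U : Functor A C) := {
  comma_ob : A;
  comma_arr : hom x (U comma_ob)
}.

Record CommaHom (A C : Category) (x : C) (U : Functor A C)
    (y z : CommaOb x U) := {
  comma_hom : hom (comma_ob y) (comma_ob z);
  comma_tri : fmap U comma_hom ∘ comma_arr y = comma_arr z
}.

Lemma CommaHom_eq (A C : Category) (x : C) (U : Functor A C)
    (y z : CommaOb x U) (f g : CommaHom y z) :
  comma_hom f = comma_hom g -> f = g.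
Proof.
  destruct f as [f Hf], g as [g Hg]; cbn; intros <-.
  now rewrite (proof_irrelevance _ Hf Hg).
Qed.

Program Definition Comma (A C : Category) (x : C) (U : Functor A C) :
    Category :=
  {| ob := CommaOb x U;
     hom := @CommaHom A C x U;
     idm := fun y => {| comma_hom := idm (comma_ob y) |};
     cmp := fun y z w g f => {| comma_hom := comma_hom g ∘ comma_hom f |} |}.
Next Obligation. intros; cbn; now rewrite fmap_id, cmp_idl. Qed.
Next Obligation. intros; cbn; now rewrite fmap_cmp, <- cmp_assoc, !comma_tri. Qed.
Next Obligation. intros; apply CommaHom_eq; apply cmp_idl. Qed.
Next Obligation. intros; apply CommaHom_eq; apply cmp_idr. Qed.
Next Obligation. intros; apply CommaHom_eq; apply cmp_assoc. Qed.

Record Initial (C : Category) := {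
  initial_ob : C;
  initial_prop : forall x : C, exists! h : hom initial_ob x, True
}.

Definition finite_category (J : Category) : Prop :=
  Finite J /\ forall i j : J, Finite (hom i j).

Definition is_cone (J C : Category) (D : Functor J C) (x : C)
    (c : forall j, hom x (D j)) : Prop :=
  forall i j (f : hom i j), fmap D f ∘ c i = c j.

Definition is_limit (J C : Category) (D : Functor J C) (x : C)
    (c : forall j, hom x (D j)) : Prop :=
  is_cone c /\
  forall (y : C) (d : forall j, hom y (D j)), is_cone d ->
    exists! h : hom y x, forall j, c j ∘ h = d j.

Definition has_finite_limits (C : Category) : Prop :=
  forall (J : Category) (D : Functor J C), finite_category J ->
    exists (x : C) (c : forall j, hom x (D j)), is_limit c.

Definition preserves_finite_limits (C C' : Category) (F : Functor C C') :
    Prop :=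
  forall (J : Category) (D : Functor J C), finite_category J ->
    forall (x : C) (c : forall j, hom x (D j)), is_limit c ->
      is_limit (D := F ⊚ D) (fun j => fmap F (c j)).

Definition cartesian (E B : Category) (p : Functor E B) (X Y : E)
    (phi : hom X Y) : Prop :=
  forall (Z : E) (psi : hom Z Y) (w : hom (p Z) (p X)),
    fmap p phi ∘ w = fmap p psi ->
    exists! chi : hom Z X, phi ∘ chi = psi /\ fmap p chi = w.

Record Cleavage (E B : Category) (p : Functor E B) := {
  reindex_ob : forall (I J : B), hom I J -> Fib p J -> Fib p I;
  lift : forall (I J : B) (u : hom I J) (Y : Fib p J),
    @hom E (fib_ob (reindex_ob u Y)) (fib_ob Y);
  lift_over : forall (I J : B) (u : hom I J) (Y : Fib p J),
    arr_eq (fmap p (lift u Y)) u;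
  lift_cartesian : forall (I J : B) (u : hom I J) (Y : Fib p J),
    cartesian p (lift u Y)
}.

Section Reindexing.
Variables (E B : Category) (p : Functor E B) (cl : Cleavage p).
Variables (I J : B) (u : hom I J).

Lemma reindex_hom_unique (Y Y' : Fib p J) (f : hom Y Y') :
  exists! g : hom (reindex_ob cl u Y) (reindex_ob cl u Y'),
    lift cl u Y' ∘ fib_hom g = fib_hom f ∘ lift cl u Y.
Proof.
  destruct (arr_eq_exists_id (fib_eq (reindex_ob cl u Y))
              (fib_eq (reindex_ob cl u Y'))) as [w Hw].
  assert (Hc : fmap p (lift cl u Y') ∘ w
               = fmap p (fib_hom f ∘ lift cl u Y)).
  { pose proof (arr_eq_cmp Hw (lift_over cl u Y')) as H1.
    pose proof (arr_eq_cmp (lift_over cl u Y) (fib_hom_id f)) as H2.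
    rewrite cmp_idr in H1; rewrite cmp_idl in H2; rewrite fmap_cmp.
    exact (arr_eq_eq (arr_eq_trans H1 (arr_eq_sym H2))). }
  destruct (lift_cartesian Hc) as (g & [Hg1 Hg2] & Hu).
  assert (Hg : arr_eq (fmap p g) (idm I)) by now rewrite Hg2.
  exists {| fib_hom := g; fib_hom_id := Hg |}; split; [exact Hg1|].
  intros g' Hg'; apply FibHom_eq; cbn; apply Hu; split; [exact Hg'|].
  apply arr_eq_eq, arr_eq_trans with (f' := idm I); [apply fib_hom_id|].
  now apply arr_eq_sym.
Qed.

Definition reindex_hom (Y Y' : Fib p J) (f : hom Y Y') :
    hom (reindex_ob cl u Y) (reindex_ob cl u Y') :=
  proj1_sig (constructive_definite_description _ (reindex_hom_unique f)).

Lemma reindex_homP (Y Y' : Fib p J) (f : hom Y Y') :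
  lift cl u Y' ∘ fib_hom (reindex_hom f) = fib_hom f ∘ lift cl u Y.
Proof.
  exact (proj2_sig (constructive_definite_description _
                      (reindex_hom_unique f))).
Qed.

Lemma reindex_hom_eq (Y Y' : Fib p J) (f : hom Y Y')
    (g : hom (reindex_ob cl u Y) (reindex_ob cl u Y')) :
  lift cl u Y' ∘ fib_hom g = fib_hom f ∘ lift cl u Y -> reindex_hom f = g.
Proof.
  intros Hg; destruct (reindex_hom_unique f) as (g0 & _ & H).
  rewrite <- (H _ Hg); symmetry; apply H, reindex_homP.
Qed.

Program Definition reindex : Functor (Fib p J) (Fib p I) :=
  {| fob := reindex_ob cl u; fmap := reindex_hom |}.
Next Obligation.
  intros; apply reindex_hom_eq; cbn; now rewrite cmp_idl, cmp_idr.
Qed.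
Next Obligation.
  intros a b c g f; apply reindex_hom_eq; cbn.
  now rewrite cmp_assoc, reindex_homP, <- !cmp_assoc, reindex_homP.
Qed.
End Reindexing.

Definition has_all_finite_limits (E B : Category) (p : Functor E B)
    (cl : Cleavage p) : Prop :=
  (forall I : B, has_finite_limits (Fib p I)) /\
  (forall (I J : B) (u : hom I J), preserves_finite_limits (reindex cl u)).

Definition vertical (E B : Category) (p : Functor E B) (X Y : E)
    (f : hom X Y) : Prop :=
  arr_eq (fmap p f) (idm (p X)).

Definition V (E B : Category) (p : Functor E B) : Category :=
  FullSub (fun f : Arr E => vertical p (arr f)).

Definition mkV (E B : Category) (p : Functor E B) (X Y : E) (f : hom X Y)
    (vf : vertical p f) : V p :=
  {| fs_ob := {| adom := X; acod := Y; arr := f |} : Arr E; fs_prop := vf |}.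

Definition vdom (E B : Category) (p : Functor E B) (f : V p) : E :=
  adom (fs_ob f).
Definition vcod (E B : Category) (p : Functor E B) (f : V p) : E :=
  acod (fs_ob f).
Definition vmap (E B : Category) (p : Functor E B) (f : V p) :
    hom (vdom f) (vcod f) := arr (fs_ob f).

Definition sdom (E B : Category) (p : Functor E B) (f g : V p) (s : hom f g) :
    hom (vdom f) (vdom g) := hdom s.
Definition scod (E B : Category) (p : Functor E B) (f g : V p) (s : hom f g) :
    hom (vcod f) (vcod g) := hcod s.

Definition mkSq (E B : Category) (p : Functor E B) (f g : V p)
    (a : hom (vdom f) (vdom g)) (b : hom (vcod f) (vcod g))
    (H : b ∘ vmap f = vmap g ∘ a) : hom f g :=
  {| hdom := a; hcod := b; hsq := H |} : ArrHom (fs_ob f) (fs_ob g).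

Lemma sq_comm (E B : Category) (p : Functor E B) (f g : V p) (s : hom f g) :
  scod s ∘ vmap f = vmap g ∘ sdom s.
Proof. apply hsq. Qed.

Lemma sq_eq (E B : Category) (p : Functor E B) (f g : V p) (s t : hom f g) :
  sdom s = sdom t -> scod s = scod t -> s = t.
Proof. apply ArrHom_eq. Qed.

Program Definition cod_functor (E B : Category) (p : Functor E B) :
    Functor (V p) E :=
  {| fob := fun f : V p => vcod f; fmap := fun f g (s : hom f g) => scod s |}.
Next Obligation. reflexivity. Qed.
Next Obligation. reflexivity. Qed.

(* [f] as an object of V(E)_Y *)
Definition fibre_vert (E B : Category) (p : Functor E B) (X Y : E)
    (f : hom X Y) (vf : vertical p f) : Fib (cod_functor p) Y :=
  {| fib_ob := mkV vf; fib_eq := eq_refl |} : FibOb (cod_functor p) Y.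

Section PointedAlgebras.
Variables (C : Category) (T : Functor C C) (eta : NatTrans (id_functor C) T).

Record PAlgOb := {
  palg_ob : C;
  palg_act : hom (T palg_ob) palg_ob;
  palg_unit : palg_act ∘ eta palg_ob = idm palg_ob
}.

Record PAlgHom (x y : PAlgOb) := {
  palg_hom : hom (palg_ob x) (palg_ob y);
  palg_hom_act : palg_hom ∘ palg_act x = palg_act y ∘ fmap T palg_hom
}.

Lemma PAlgHom_eq (x y : PAlgOb) (f g : PAlgHom x y) :
  palg_hom f = palg_hom g -> f = g.
Proof.
  destruct f as [f Hf], g as [g Hg]; cbn; intros <-.
  now rewrite (proof_irrelevance _ Hf Hg).
Qed.

Program Definition PAlg : Category :=
  {| ob := PAlgOb;
     hom := PAlgHom;
     idm := fun x => {| palg_hom := idm (palg_ob x) |};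
     cmp := fun x y z g f => {| palg_hom := palg_hom g ∘ palg_hom f |} |}.
Next Obligation. intros; cbn; now rewrite fmap_id, cmp_idl, cmp_idr. Qed.
Next Obligation.
  intros; cbn; rewrite fmap_cmp, <- cmp_assoc, palg_hom_act.
  now rewrite cmp_assoc, palg_hom_act, cmp_assoc.
Qed.
Next Obligation. intros; apply PAlgHom_eq; apply cmp_idl. Qed.
Next Obligation. intros; apply PAlgHom_eq; apply cmp_idr. Qed.
Next Obligation. intros; apply PAlgHom_eq; apply cmp_assoc. Qed.

Program Definition palg_forget : Functor PAlg C :=
  {| fob := fun x : PAlg => palg_ob x;
     fmap := fun x y (f : @hom PAlg x y) => palg_hom f |}.
Next Obligation. reflexivity. Qed.
Next Obligation. reflexivity. Qed.

Variable mu : NatTrans (T ⊚ T) T.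

Definition is_monad : Prop :=
  (forall x, mu x ∘ eta (T x) = idm (T x)) /\
  (forall x, mu x ∘ fmap T (eta x) = idm (T x)) /\
  (forall x, mu x ∘ fmap T (mu x) = mu x ∘ mu (T x)).

Definition MAlg : Category :=
  FullSub (fun x : PAlg =>
    palg_act x ∘ fmap T (palg_act x) = palg_act x ∘ mu (palg_ob x)).

Definition malg_forget : Functor MAlg PAlg := fs_inclusion _.
End PointedAlgebras.

Section PointedMorphism.
Variables (C : Category) (T T' : Functor C C).
Variables (eta : NatTrans (id_functor C) T) (eta' : NatTrans (id_functor C) T').
Variables (xi : NatTrans T T') (xi_unit : forall x, xi x ∘ eta x = eta' x).

Program Definition palg_induced : Functor (PAlg eta') (PAlg eta) :=
  {| fob := fun x : PAlg eta' =>
       {| palg_ob := palg_ob x; palg_act := palg_act x ∘ xi (palg_ob x) |}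
       : PAlg eta;
     fmap := fun x y f => {| palg_hom := palg_hom f |} |}.
Next Obligation.
  intros; cbn; rewrite <- cmp_assoc.
  etransitivity; [exact (f_equal _ (xi_unit _)) | apply palg_unit].
Qed.
Next Obligation.
  intros; cbn.
  now rewrite cmp_assoc, palg_hom_act, <- !cmp_assoc, nt_nat.
Qed.
Next Obligation. intros; now apply PAlgHom_eq. Qed.
Next Obligation. intros; now apply PAlgHom_eq. Qed.
End PointedMorphism.

Definition is_comonad (C : Category) (W : Functor C C)
    (eps : NatTrans W (id_functor C)) (delta : NatTrans W (W ⊚ W)) : Prop :=
  (forall x, eps (W x) ∘ delta x = idm (W x)) /\
  (forall x, fmap W (eps x) ∘ delta x = idm (W x)) /\
  (forall x, fmap W (delta x) ∘ delta x = delta (W x) ∘ delta x).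

(* Distributive law of the comonad (W, eps, delta) over the monad
   (T, eta, mu). *)
Definition is_distributive_law (C : Category) (W T : Functor C C)
    (eps : NatTrans W (id_functor C)) (delta : NatTrans W (W ⊚ W))
    (eta : NatTrans (id_functor C) T) (mu : NatTrans (T ⊚ T) T)
    (d : NatTrans (W ⊚ T) (T ⊚ W)) : Prop :=
  (forall x, d x ∘ fmap W (eta x) = eta (W x)) /\
  (forall x, d x ∘ fmap W (mu x) = mu (W x) ∘ fmap T (d x) ∘ d (T x)) /\
  (forall x, fmap T (eps x) ∘ d x = eps (T x)) /\
  (forall x, fmap T (delta x) ∘ d x = d (W x) ∘ fmap W (d x) ∘ delta (T x)).

(* A functorial section of the composition functor on pairs of composable
   vertical maps.  That [Kf] is over the same object as [f], and that
   [fmap fK s] lies over the same arrow as [s], follows from verticality of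
   [fL f] and [fR f]. *)
Record FFact (E B : Category) (p : Functor E B) := {
  fK : Functor (V p) E;
  fL : forall f : V p, hom (vdom f) (fK f);
  fR : forall f : V p, hom (fK f) (vcod f);
  fL_vert : forall f, vertical p (fL f);
  fR_vert : forall f, vertical p (fR f);
  fL_nat : forall (f g : V p) (s : hom f g), fmap fK s ∘ fL f = fL g ∘ sdom s;
  fR_nat : forall (f g : V p) (s : hom f g), scod s ∘ fR f = fR g ∘ fmap fK s;
  fRL : forall f, fR f ∘ fL f = vmap f
}.

Section FFactFunctors.
Variables (E B : Category) (p : Functor E B) (F : FFact p).

(* [dom (Lf)] is [dom f] and [cod (Rf)] is [cod f] definitionally. *)
Program Definition Lfun : Functor (V p) (V p) :=
  {| fob := fun f => mkV (fL_vert F f);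
     fmap := fun f g s =>
       mkSq (f := mkV (fL_vert F f)) (g := mkV (fL_vert F g))
         (a := sdom s) (b := fmap (fK F) s) (fL_nat F s) |}.
Next Obligation. intros; apply sq_eq; [reflexivity | apply fmap_id]. Qed.
Next Obligation. intros; apply sq_eq; [reflexivity | apply fmap_cmp]. Qed.

Program Definition Rfun : Functor (V p) (V p) :=
  {| fob := fun f => mkV (fR_vert F f);
     fmap := fun f g s =>
       mkSq (f := mkV (fR_vert F f)) (g := mkV (fR_vert F g))
         (a := fmap (fK F) s) (b := scod s) (fR_nat F s) |}.
Next Obligation. intros; apply sq_eq; [apply fmap_id | reflexivity]. Qed.
Next Obligation. intros; apply sq_eq; [apply fmap_cmp | reflexivity]. Qed.

Program Definition lam : NatTrans (id_functor (V p)) Rfun :=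
  {| nt := fun f => mkSq (f := f) (g := Rfun f)
                      (a := fL F f) (b := idm (vcod f)) _ |}.
Next Obligation.
  intros; cbn; rewrite cmp_idl; symmetry; apply fRL.
Qed.
Next Obligation.
  intros; apply sq_eq.
  - symmetry; apply fL_nat.
  - cbn; etransitivity; [apply cmp_idl | symmetry; apply cmp_idr].
Qed.

Program Definition rho : NatTrans Lfun (id_functor (V p)) :=
  {| nt := fun f => mkSq (f := Lfun f) (g := f)
                      (a := idm (vdom f)) (b := fR F f) _ |}.
Next Obligation.
  intros; cbn; rewrite cmp_idr; apply fRL.
Qed.
Next Obligation.
  intros; apply sq_eq.
  - cbn; etransitivity; [apply cmp_idl | symmetry; apply cmp_idr].
  - symmetry; apply fR_nat.
Qed.
End FFactFunctors.

Record Lawfs (E B : Category) (p : Functor E B) := {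
  lawfs_fact :> FFact p;
  Sig : NatTrans (Lfun lawfs_fact) (Lfun lawfs_fact ⊚ Lfun lawfs_fact);
  Sig_dom : forall f, sdom (Sig f) = idm (vdom f);
  Sig_comonad : is_comonad (rho lawfs_fact) Sig
}.

Section CanonicalLaw.
Variables (E B : Category) (p : Functor E B) (A : Lawfs p).
Variables (Pi : NatTrans (Rfun A ⊚ Rfun A) (Rfun A)).
Hypothesis Pi_monad : is_monad (lam A) Pi.

Definition delta (f : V p) : hom (fK A f) (fK A (Lfun A f)) := scod (Sig A f).
Definition pi (f : V p) : hom (fK A (Rfun A f)) (fK A f) := sdom (Pi f).

Lemma fR_delta f : fR A (Lfun A f) ∘ delta f = idm (fK A f).
Proof.
  destruct (Sig_comonad A) as [H _].
  exact (f_equal (fun s => scod s) (H f)).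
Qed.

Lemma pi_fL f : pi f ∘ fL A (Rfun A f) = idm (fK A f).
Proof.
  destruct Pi_monad as [H _].
  exact (f_equal (fun s => sdom s) (H f)).
Qed.

Lemma canonical_sq f :
  pi f ∘ fL A (Rfun A f) = fR A (Lfun A f) ∘ delta f.
Proof. now rewrite fR_delta, pi_fL. Qed.

(* The square (delta_f, pi_f) from LRf to RLf. *)
Program Definition canonical_law :
    NatTrans (Lfun A ⊚ Rfun A) (Rfun A ⊚ Lfun A) :=
  {| nt := fun f =>
       mkSq (f := Lfun A (Rfun A f)) (g := Rfun A (Lfun A f))
         (a := delta f) (b := pi f) (canonical_sq f) |}.
Next Obligation.
  intros f g s; apply sq_eq.
  - exact (f_equal (fun t => scod t) (nt_nat (Sig A) s)).
  - exact (f_equal (fun t => sdom t) (nt_nat Pi s)).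
Qed.
End CanonicalLaw.

Record Awfs (E B : Category) (p : Functor E B) := {
  awfs_lawfs :> Lawfs p;
  Pi : NatTrans (Rfun awfs_lawfs ⊚ Rfun awfs_lawfs) (Rfun awfs_lawfs);
  Pi_cod : forall f, scod (Pi f) = idm (vcod f);
  Pi_monad : is_monad (lam awfs_lawfs) Pi;
  awfs_distr : is_distributive_law (rho awfs_lawfs) (Sig awfs_lawfs)
                 (lam awfs_lawfs) Pi (canonical_law Pi_monad)
}.

(* A natural transformation of factorisation functors with identity
   components at domains and codomains. *)
Record FFactMor (E B : Category) (p : Functor E B) (F F' : FFact p) := {
  fmor :> NatTrans (fK F) (fK F');
  fmor_L : forall f, fmor f ∘ fL F f = fL F' f;
  fmor_R : forall f, fR F' f ∘ fmor f = fR F f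
}.

Section Induced.
Variables (E B : Category) (p : Functor E B) (F F' : FFact p).
Variable m : FFactMor F F'.

Program Definition Lmor : NatTrans (Lfun F) (Lfun F') :=
  {| nt := fun f => mkSq (f := Lfun F f) (g := Lfun F' f)
                      (a := idm (vdom f)) (b := m f) _ |}.
Next Obligation. intros; cbn; rewrite cmp_idr; apply fmor_L. Qed.
Next Obligation.
  intros; apply sq_eq.
  - cbn; etransitivity; [apply cmp_idl | symmetry; apply cmp_idr].
  - apply nt_nat.
Qed.

Program Definition Rmor : NatTrans (Rfun F) (Rfun F') :=
  {| nt := fun f => mkSq (f := Rfun F f) (g := Rfun F' f)
                      (a := m f) (b := idm (vcod f)) _ |}.
Next Obligation. intros; cbn; rewrite cmp_idl; symmetry; apply fmor_R. Qed.
Next Obligation.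
  intros; apply sq_eq.
  - apply nt_nat.
  - cbn; etransitivity; [apply cmp_idl | symmetry; apply cmp_idr].
Qed.

Lemma Rmor_unit f : Rmor f ∘ lam F f = lam F' f.
Proof. apply sq_eq; [apply fmor_L | apply cmp_idl]. Qed.

Definition ralg_induced : Functor (PAlg (lam F')) (PAlg (lam F)) :=
  palg_induced Rmor_unit.
End Induced.

Record LawfsMor (E B : Category) (p : Functor E B) (A A' : Lawfs p) := {
  lmor :> FFactMor A A';
  lmor_comult : forall f,
    Sig A' f ∘ Lmor lmor f
    = fmap (Lfun A') (Lmor lmor f) ∘ Lmor lmor (Lfun A f) ∘ Sig A f
}.

Definition algebraically_free (E B : Category) (p : Functor E B)
    (A : Lawfs p) (A' : Awfs p) (m : LawfsMor A A') : Prop :=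
  is_iso_functor (ralg_induced m ⊚ malg_forget (lam A') (Pi A')).

(* Main.v *)
(* [R_1]-algebras can be pulled back along every [u : Y -> Y'], so an algebra
   that is free on [f] in the fibre over [Y] is free among all [R_1]-algebras: a
   square [f -> g] over [u] factors through the algebra [u^* g].  The free
   algebras [Rf] thus form a monad [R] over [cod], whose algebras are the
   [R_1]-algebras.

   The comultiplication [Σ_1] allows [R_1]-algebras to be composed vertically,
   associatively and functorially (an algebra lifts against coalgebras, and
   [Σ_1] makes [L_1 f] a coalgebra).  Hence [Rf ∘ RLf] is an algebra, and
   [δ_f : Kf -> KLf] is the algebra morphism [Rf -> Rf ∘ RLf] that freeness
   provides.  All the comonad and distributive laws are equalities between
   algebra morphisms out of a free algebra, checked on the unit [Lf]. *)
From Stdlib Require Import ClassicalEpsilon FunctionalExtensionality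
  Eqdep_dec List.
Require Import Defs.

Set Implicit Arguments.
Unset Strict Implicit.

(** * Equality of arrows with varying endpoints, and of functors *)

Lemma arr_eq_obj (C : Category) (a b a' b' : C) (f : hom a b) (f' : hom a' b') :
  arr_eq f f' -> a = a' /\ b = b'.
Proof. intros []; now split. Qed.

Lemma arr_eq_retarget (C : Category) (a b d : C) (k : hom a b) :
  d = b -> exists w : hom a d, arr_eq w k.
Proof. intros ->; exists k; constructor. Qed.

Lemma cmp_congl (C : Category) (a b c : C) (g g' : hom b c) (f : hom a b) :
  g = g' -> g ∘ f = g' ∘ f.
Proof. now intros ->. Qed.

Lemma cmp_congr (C : Category) (a b c : C) (g : hom b c) (f f' : hom a b) :
  f = f' -> g ∘ f = g ∘ f'.
Proof. now intros ->. Qed.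

Lemma fmap_id_cmp (C D : Category) (F : Functor C D) (a : C) (b : D)
    (x : hom b (F a)) : fmap F (idm a) ∘ x = x.
Proof. now rewrite fmap_id, cmp_idl. Qed.

Lemma arr_eq_id_cmp (C : Category) (a b d e : C) (f : hom a b) (g : hom b e) :
  arr_eq g (idm d) -> arr_eq (g ∘ f) f.
Proof.
  intros Hg; destruct (arr_eq_obj Hg) as [-> ->].
  rewrite (arr_eq_eq Hg), cmp_idl; constructor.
Qed.

(** Since [arr_eq] also identifies endpoints, the hypothesis at identities gives equality on
    objects; after that it is ordinary equality of arrows. *)
Lemma functor_eq (C D : Category) (F G : Functor C D) :
  (forall a b (f : hom a b), arr_eq (fmap F f) (fmap G f)) -> F = G.
Proof.
  destruct F as [F0 F1 Fid Fcmp], G as [G0 G1 Gid Gcmp]; cbn; intros H.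
  assert (H0 : F0 = G0).
  { apply functional_extensionality; intros a.
    exact (proj1 (arr_eq_obj (H a a (idm a)))). }
  destruct H0.
  assert (H1 : F1 = G1).
  { apply functional_extensionality_dep; intros a.
    apply functional_extensionality_dep; intros b.
    apply functional_extensionality; intros f; exact (arr_eq_eq (H a b f)). }
  destruct H1.
  now rewrite (proof_irrelevance _ Fid Gid), (proof_irrelevance _ Fcmp Gcmp).
Qed.

Lemma arr_eq_FullSub (C : Category) (P : C -> Prop) (x y x' y' : FullSub P)
    (f : hom x y) (f' : hom x' y') :
  @arr_eq C (fs_ob x) (fs_ob y) f (fs_ob x') (fs_ob y') f' -> arr_eq f f'.
Proof.
  destruct x as [x hx], y as [y hy], x' as [x' hx'], y' as [y' hy']; cbn.
  intros H; destruct H.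
  rewrite (proof_irrelevance _ hx' hx), (proof_irrelevance _ hy' hy).
  constructor.
Qed.

(** Made for the round trips between categories of algebras: they return the same underlying object
    by definition, but an action that is only provably the old one. *)
Lemma arr_eq_PAlg (C : Category) (T : Functor C C)
    (eta : NatTrans (id_functor C) T) (x y : PAlg eta)
    (al : hom (T (palg_ob x)) (palg_ob x))
    (be : hom (T (palg_ob y)) (palg_ob y))
    (Hal : al ∘ eta (palg_ob x) = idm (palg_ob x))
    (Hbe : be ∘ eta (palg_ob y) = idm (palg_ob y))
    (x' := {| palg_ob := palg_ob x; palg_act := al; palg_unit := Hal |}
           : PAlg eta)
    (y' := {| palg_ob := palg_ob y; palg_act := be; palg_unit := Hbe |}
           : PAlg eta)
    (f : hom x y) (f' : hom x' y') :
  al = palg_act x -> be = palg_act y -> palg_hom f' = palg_hom f ->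
  arr_eq f' f.
Proof.
  destruct x as [x al0 h0], y as [y be0 h1]; cbn in *; intros -> -> Hf.
  revert f' Hf; unfold x', y'.
  rewrite (proof_irrelevance _ Hal h0), (proof_irrelevance _ Hbe h1).
  intros f' Hf; rewrite (@PAlgHom_eq C T eta _ _ f' f Hf); constructor.
Qed.

(** * Closure properties of vertical maps *)

Section VerticalMaps.
Variables (E B : Category) (p : Functor E B).

Lemma vertical_obj (X Y : E) (f : hom X Y) : vertical p f -> p Y = p X.
Proof. intros Hf; exact (proj2 (arr_eq_obj Hf)). Qed.

Lemma vertical_cmp (X Y Z : E) (f : hom X Y) (g : hom Y Z) :
  vertical p f -> vertical p g -> vertical p (g ∘ f).
Proof.
  unfold vertical; intros Hf Hg; rewrite fmap_cmp.
  exact (arr_eq_trans (arr_eq_id_cmp _ Hg) Hf).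
Qed.

Lemma vertical_over (X Y Z : E) (f : hom X Y) (g : hom Y Z) :
  vertical p g -> arr_eq (fmap p (g ∘ f)) (fmap p f).
Proof. intros Hg; rewrite fmap_cmp; exact (arr_eq_id_cmp _ Hg). Qed.

Lemma vertical_cancel (X Y Z : E) (f : hom X Y) (g : hom Y Z) :
  vertical p g -> vertical p (g ∘ f) -> vertical p f.
Proof.
  intros Hg Hgf; exact (arr_eq_trans (arr_eq_sym (vertical_over f Hg)) Hgf).
Qed.

Lemma vertical_fib (I : B) (X Y : FibOb p I) (f : FibHom X Y) :
  vertical p (fib_hom f).
Proof.
  refine (arr_eq_trans (fib_hom_id f) (arr_eq_idm _)); symmetry; apply fib_eq.
Qed.

Lemma fib_vertical (I : B) (X Y : FibOb p I) (f : @hom E X Y) :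
  vertical p f -> arr_eq (fmap p f) (idm I).
Proof. intros Hf; exact (arr_eq_trans Hf (arr_eq_idm (fib_eq X))). Qed.

End VerticalMaps.

(** * The finite category that indexes pullbacks *)

Section Cospan.

Inductive cospan_ob := cs_l | cs_r | cs_o.

Definition cospan_le (i j : cospan_ob) : bool :=
  match i, j with
  | cs_l, cs_l | cs_r, cs_r | _, cs_o => true
  | _, _ => false
  end.

(** Arrows are proofs of a boolean equation, so parallel arrows are equal by [UIP_dec]; this settles
    the category laws and finiteness. *)
Program Definition cospan : Category :=
  {| ob := cospan_ob;
     hom := fun i j => cospan_le i j = true;
     idm := fun i => _;
     cmp := fun i j k g f => _ |}.
Next Obligation. now destruct i. Qed.
Next Obligation. now destruct i, j, k. Qed.
Next Obligation. apply (UIP_dec Bool.bool_dec). Qed.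
Next Obligation. apply (UIP_dec Bool.bool_dec). Qed.
Next Obligation. apply (UIP_dec Bool.bool_dec). Qed.

Lemma cospan_finite : finite_category cospan.
Proof.
  split.
  - exists (cs_l :: cs_r :: cs_o :: nil); intros []; cbn; tauto.
  - intros i j; cbn; destruct (cospan_le i j) eqn:Hij.
    + exists (eq_refl :: nil); intros e; left; apply (UIP_dec Bool.bool_dec).
    + exists nil; intros e; discriminate.
Qed.

Variables (C : Category) (a b c : C) (f : hom a c) (g : hom b c).

Definition cospan_fob (i : cospan_ob) : C :=
  match i with cs_l => a | cs_r => b | cs_o => c end.

Definition cospan_fmap (i j : cospan_ob) :
    cospan_le i j = true -> hom (cospan_fob i) (cospan_fob j) :=
  match i, j with
  | cs_l, cs_l => fun _ => idm a
  | cs_r, cs_r => fun _ => idm b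
  | cs_o, cs_o => fun _ => idm c
  | cs_l, cs_o => fun _ => f
  | cs_r, cs_o => fun _ => g
  | _, _ => fun e => False_rect _ (Bool.diff_false_true e)
  end.

Program Definition cospan_diagram : Functor cospan C :=
  {| fob := cospan_fob; fmap := cospan_fmap |}.
Next Obligation. now destruct a0. Qed.
Next Obligation.
  destruct a0, b0, c0; try discriminate; cbn;
    now rewrite ?cmp_idl, ?cmp_idr.
Qed.

End Cospan.

(** * Factorisation through cartesian lifts *)

Section LiftFactor.
Variables (E B : Category) (p : Functor E B) (cl : Cleavage p).
Variables (I J : B) (v : hom I J) (Y : Fib p J).

(** Existence half of cartesianness. With [arr_eq], [k] can end in [I] itself, to which the image of
    the reindexed object is only propositionally equal. *)
Lemma lift_factor (Z : E) (psi : hom Z (fib_ob Y)) (k : hom (p Z) I) :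
  arr_eq (fmap p psi) (v ∘ k) ->
  exists chi : hom Z (fib_ob (reindex_ob cl v Y)),
    lift cl v Y ∘ chi = psi /\ arr_eq (fmap p chi) k.
Proof.
  intros H; destruct (arr_eq_retarget k (fib_eq (reindex_ob cl v Y))) as [w Hw].
  assert (Hc : fmap p (lift cl v Y) ∘ w = fmap p psi).
  { apply arr_eq_eq.
    exact (arr_eq_trans (arr_eq_cmp Hw (lift_over cl v Y)) (arr_eq_sym H)). }
  destruct (lift_cartesian Hc) as (chi & [H1 H2] & _).
  exists chi; split; [exact H1 | now rewrite H2].
Qed.

Lemma lift_mono (Z : E) (chi chi' : hom Z (fib_ob (reindex_ob cl v Y))) :
  arr_eq (fmap p chi) (fmap p chi') ->
  lift cl v Y ∘ chi = lift cl v Y ∘ chi' -> chi = chi'.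
Proof.
  intros Hp H.
  destruct (lift_cartesian (Y := Y) (psi := lift cl v Y ∘ chi')
              (w := fmap p chi'))
    as (chi0 & _ & Hu).
  { symmetry; apply fmap_cmp. }
  rewrite <- (Hu chi (conj H (arr_eq_eq Hp))); apply Hu; now split.
Qed.

End LiftFactor.

(** * Pullbacks of vertical maps along arbitrary maps *)

Section Pullback.
Variables (E B : Category) (p : Functor E B) (cl : Cleavage p).
Hypothesis Hlim : has_all_finite_limits cl.

(** Reindexing along [p u] brings [g] into the fibre over [p Y], where the pullback is taken.
    Stability of finite limits under reindexing extends its universal property from that fibre to
    all of [E]. *)
Lemma vertical_pullback (Y Y' Z : E) (u : hom Y Y') (g : hom Z Y') :
  vertical p g ->
  exists (P : E) (g' : hom P Y) (u' : hom P Z),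
    vertical p g' /\ u ∘ g' = g ∘ u' /\
    forall (W : E) (x : hom W Y) (y : hom W Z), u ∘ x = g ∘ y ->
      exists! t : hom W P, g' ∘ t = x /\ u' ∘ t = y.
Proof.
  intros vg; set (v := fmap p u).
  pose (YI := {| fib_ob := Y; fib_eq := eq_refl |} : Fib p (p Y)).
  pose (YJ := {| fib_ob := Y'; fib_eq := eq_refl |} : Fib p (p Y')).
  pose (ZJ := {| fib_ob := Z; fib_eq := eq_sym (vertical_obj vg) |}
              : Fib p (p Y')).
  pose (gJ := {| fib_hom := g : @hom E (fib_ob ZJ) (fib_ob YJ);
                 fib_hom_id := fib_vertical (X := ZJ) (Y := YJ) vg |}
              : @hom (Fib p (p Y')) ZJ YJ).
  pose (gv := fmap (reindex cl v) gJ).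
  assert (Hgv : lift cl v YJ ∘ fib_hom gv = g ∘ lift cl v ZJ)
    by exact (reindex_homP cl v gJ).
  (* [u] is split into a vertical map [uv] followed by the cartesian lift of [v]. *)
  destruct (lift_factor cl (v := v) (Y := YJ) (psi := u) (k := idm (p Y)))
    as (uv & Huv & vuv).
  { rewrite cmp_idr; constructor. }
  pose (ubar := @Build_FibHom _ _ p _ YI (reindex_ob cl v YJ) uv vuv
              : @hom (Fib p (p Y)) YI (reindex cl v YJ)).
  destruct (proj1 Hlim (p Y) cospan (cospan_diagram ubar gv) cospan_finite)
    as (P & c & Hc).
  pose (cl_ := c cs_l : FibHom P YI).
  pose (cr_ := c cs_r : FibHom P (reindex_ob cl v ZJ)).
  assert (Hcone : uv ∘ fib_hom cl_ = fib_hom gv ∘ fib_hom cr_).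
  { pose proof (proj1 Hc cs_l cs_o eq_refl) as H1.
    pose proof (proj1 Hc cs_r cs_o eq_refl) as H2.
    exact (f_equal (@fib_hom _ _ _ _ _ _) (eq_trans H1 (eq_sym H2))). }
  exists (fib_ob P), (fib_hom cl_), (lift cl v ZJ ∘ fib_hom cr_).
  split; [exact (vertical_fib cl_) | split].
  { rewrite <- Huv, <- cmp_assoc.
    refine (eq_trans (f_equal _ Hcone) _); rewrite cmp_assoc.
    refine (eq_trans (cmp_congl _ Hgv) _).
    symmetry; apply cmp_assoc. }
  intros W x y Hxy.
  (* The test object [W] may lie over any object, so the cospan is reindexed along [k] into the
     fibre over [p W]. There [x] becomes [xbar], and [y], factored first through the lift of [v] and
     then through that of [k], becomes [ybar]. *)
  set (k := fmap p x).
  pose (WK := {| fib_ob := W; fib_eq := eq_refl |} : Fib p (p W)).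
  destruct (lift_factor cl (v := k) (Y := YI) (psi := x) (k := idm (p W)))
    as (xb & Hxb & vxb).
  { rewrite cmp_idr; constructor. }
  assert (Hpy : arr_eq (fmap p y) (v ∘ k)).
  { apply arr_eq_trans with (1 := arr_eq_sym (vertical_over y vg)).
    rewrite <- Hxy, fmap_cmp; constructor. }
  destruct (lift_factor cl (v := v) (Y := ZJ) (psi := y) Hpy)
    as (y' & Hy' & vy').
  destruct (lift_factor cl (v := k) (Y := reindex_ob cl v ZJ) (psi := y')
              (k := idm (p W)))
    as (yb & Hyb & vyb).
  { now rewrite cmp_idr. }
  pose (xbar := @Build_FibHom _ _ p _ WK (reindex_ob cl k YI) xb vxb
              : @hom (Fib p (p W)) WK (reindex cl k YI)).
  pose (ybar := @Build_FibHom _ _ p _ WK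
                  (reindex_ob cl k (reindex_ob cl v ZJ)) yb vyb
              : @hom (Fib p (p W)) WK (reindex cl k (reindex cl v ZJ))).
  assert (Hsq' : uv ∘ x = fib_hom gv ∘ y').
  { apply (lift_mono (cl := cl) (v := v) (Y := YJ)).
    - apply arr_eq_trans with (1 := vertical_over x (vertical_fib ubar)).
      apply arr_eq_sym.
      apply arr_eq_trans with (1 := vertical_over y' (vertical_fib gv)).
      exact vy'.
    - rewrite !cmp_assoc, Huv.
      refine (eq_trans Hxy (eq_trans _ (cmp_congl _ (eq_sym Hgv)))).
      rewrite <- Hy'; apply cmp_assoc. }
  assert (Hcone' : fmap (reindex cl k) ubar ∘ xbar
                   = fmap (reindex cl k) gv ∘ ybar).
  { apply FibHom_eq, (lift_mono (cl := cl) (v := k) (Y := reindex_ob cl v YJ)).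
    - apply arr_eq_trans
        with (1 := fib_hom_id (fmap (reindex cl k) ubar ∘ xbar)).
      apply arr_eq_sym, (fib_hom_id (fmap (reindex cl k) gv ∘ ybar)).
    - cbn; rewrite !cmp_assoc, !(reindex_homP cl k); cbn.
      rewrite <- !cmp_assoc.
      refine (eq_trans (f_equal _ Hxb) _).
      etransitivity; [exact Hsq'|].
      exact (f_equal _ (eq_sym Hyb)). }
  (* The reindexed cone is still a limit, so [xbar] and [ybar] induce [h]; the mediating map is [h]
     followed by the lift of [k] at [P]. *)
  destruct (proj2 Hlim _ _ k cospan (cospan_diagram ubar gv) cospan_finite
              P c Hc) as [_ Hk].
  pose (d := fun j : cospan =>
    match j return @hom (Fib p (p W)) WK
                     (reindex cl k (cospan_diagram ubar gv j)) with
    | cs_l => xbar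
    | cs_r => ybar
    | cs_o => fmap (reindex cl k) ubar ∘ xbar
    end).
  destruct (Hk WK d) as (h & Hh & hu).
  { intros [] [] e; try discriminate e.
    - exact (fmap_id_cmp (F := reindex cl k) xbar).
    - reflexivity.
    - exact (fmap_id_cmp (F := reindex cl k) ybar).
    - exact (eq_sym Hcone').
    - exact (fmap_id_cmp (F := reindex cl k) (fmap (reindex cl k) ubar ∘ xbar)). }
  pose proof (f_equal (@fib_hom _ _ _ _ _ _) (Hh cs_l)) as Hl; cbn in Hl.
  pose proof (f_equal (@fib_hom _ _ _ _ _ _) (Hh cs_r)) as Hr; cbn in Hr.
  exists (lift cl k P ∘ fib_hom h); split.
  - split.
    + rewrite cmp_assoc.
      refine (eq_trans (cmp_congl _ (eq_sym (reindex_homP cl k cl_))) _).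
      rewrite <- cmp_assoc, <- Hxb; exact (f_equal _ Hl).
    + rewrite <- Hy', <- Hyb, <- cmp_assoc; f_equal.
      rewrite cmp_assoc.
      refine (eq_trans (cmp_congl _ (eq_sym (reindex_homP cl k cr_))) _).
      rewrite <- cmp_assoc; exact (f_equal _ Hr).
  - intros t [Ht1 Ht2].
    (* Any competitor lies over [k] because [cl_] is vertical; its vertical part [tbar] is then
       compared with [h] in the fibre over [p W]. *)
    assert (Hpt : arr_eq (fmap p t) k).
    { apply arr_eq_trans
        with (1 := arr_eq_sym (vertical_over t (vertical_fib cl_))).
      exact (eq_ind_r (fun z => arr_eq (fmap p z) k) (arr_eq_refl k) Ht1). }
    destruct (lift_factor cl (v := k) (Y := P) (psi := t) (k := idm (p W)))
      as (tb & Htb & vtb).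
    { now rewrite cmp_idr. }
    pose (tbar := @Build_FibHom _ _ p _ WK (reindex_ob cl k P) tb vtb
              : @hom (Fib p (p W)) WK (reindex cl k P)).
    rewrite <- Htb; f_equal.
    refine (f_equal (@fib_hom _ _ _ _ _ _) (hu tbar _)).
    assert (Hkl : fmap (reindex cl k) (c cs_l) ∘ tbar = xbar).
    { apply FibHom_eq, (lift_mono (cl := cl) (v := k) (Y := YI)).
      - apply arr_eq_trans
          with (1 := fib_hom_id (fmap (reindex cl k) (c cs_l) ∘ tbar)).
        apply arr_eq_sym, (fib_hom_id xbar).
      - cbn; rewrite cmp_assoc.
        refine (eq_trans (cmp_congl _ (reindex_homP cl k cl_)) _).
        rewrite <- cmp_assoc.
        refine (eq_trans (f_equal _ Htb) _).
        exact (eq_trans Ht1 (eq_sym Hxb)). }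
    assert (Hkr : fmap (reindex cl k) (c cs_r) ∘ tbar = ybar).
    { apply FibHom_eq,
        (lift_mono (cl := cl) (v := k) (Y := reindex_ob cl v ZJ)).
      - apply arr_eq_trans
          with (1 := fib_hom_id (fmap (reindex cl k) (c cs_r) ∘ tbar)).
        apply arr_eq_sym, (fib_hom_id ybar).
      - cbn; rewrite cmp_assoc.
        refine (eq_trans (cmp_congl _ (reindex_homP cl k cr_)) _).
        rewrite <- cmp_assoc.
        refine (eq_trans (f_equal _ Htb) _).
        etransitivity; [|exact (eq_sym Hyb)].
        apply (lift_mono (cl := cl) (v := v) (Y := ZJ)).
        + apply arr_eq_trans with (1 := vertical_over t (vertical_fib cr_)).
          apply arr_eq_sym; apply arr_eq_trans with (1 := vy').
          now apply arr_eq_sym.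
        + rewrite Hy', cmp_assoc; exact Ht2. }
    intros []; unfold d.
    + exact Hkl.
    + exact Hkr.
    + rewrite <- Hkl, cmp_assoc.
      apply (f_equal (fun z => z ∘ tbar)).
      refine (eq_trans (f_equal (fmap (reindex cl k)) _)
                (fmap_cmp (reindex cl k) ubar (c cs_l))).
      exact (eq_sym (proj1 Hc cs_l cs_o eq_refl)).
Qed.

End Pullback.

(** * The comonad laws read on codomain components *)

Section Comultiplication.
Variables (E B : Category) (p : Functor E B) (A : Lawfs p).

Lemma delta_fL (f : V p) : delta A f ∘ fL A f = fL A (Lfun A f).
Proof.
  refine (eq_trans (sq_comm (Sig A f)) _).
  rewrite Sig_dom; apply cmp_idr.
Qed.

Lemma fK_rho_delta (f : V p) :
  fmap (fK A) (rho A f) ∘ delta A f = idm (fK A f).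
Proof.
  exact (f_equal (fun s => scod s) (proj1 (proj2 (Sig_comonad A)) f)).
Qed.

Lemma delta_nat (f g : V p) (s : hom f g) :
  delta A g ∘ fmap (fK A) s = fmap (fK A) (fmap (Lfun A) s) ∘ delta A f.
Proof. exact (f_equal (fun s => scod s) (nt_nat (Sig A) s)). Qed.

Lemma delta_coassoc (f : V p) :
  delta A (Lfun A f) ∘ delta A f = fmap (fK A) (Sig A f) ∘ delta A f.
Proof.
  exact (eq_sym (f_equal (fun s => scod s) (proj2 (proj2 (Sig_comonad A)) f))).
Qed.

End Comultiplication.

(** * Algebra structures and their vertical composition *)

Section Actions.
Variables (E B : Category) (p : Functor E B) (A : Lawfs p).

(* An algebra structure on [g] for the pointed endofunctor [R] has identity
   codomain component, so only its domain component is recorded. *)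
Record action (g : V p) := {
  act :> hom (fK A g) (vdom g);
  act_unit : act ∘ fL A g = idm (vdom g);
  act_over : vmap g ∘ act = fR A g
}.

Definition act_mor (g g' : V p) (a : action g) (a' : action g')
    (s : hom g g') : Prop :=
  sdom s ∘ a = a' ∘ fmap (fK A) s.

Lemma act_mor_id (g : V p) (a : action g) : act_mor a a (idm g).
Proof.
  unfold act_mor; rewrite fmap_id, cmp_idr; apply cmp_idl.
Qed.

Lemma act_mor_cmp (f g h : V p) (a : action f) (b : action g) (c : action h)
    (t : hom g h) (s : hom f g) :
  act_mor b c t -> act_mor a b s -> act_mor a c (t ∘ s).
Proof.
  unfold act_mor; intros Ht Hs.
  rewrite fmap_cmp, cmp_assoc, <- Ht, <- cmp_assoc, <- Hs; symmetry.
  apply cmp_assoc.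
Qed.

Lemma act_mor_eq (f g : V p) (a : action f) (b : action g) (s t : hom f g) :
  sdom s = sdom t -> scod s = scod t -> act_mor a b s -> act_mor a b t.
Proof. intros H1 H2; now rewrite (sq_eq H1 H2). Qed.

Section Composite.
Variables (X Y Z : E) (g : hom X Y) (h : hom Y Z) (f : hom X Z).
Variables (vg : vertical p g) (vh : vertical p h) (vf : vertical p f).
Hypothesis (e : h ∘ g = f).

(** The composite is a separate variable [f], tied to [h ∘ g] by [e], so that both bracketings of a
    triple composite can be structures on one and the same object. *)
Definition cmp_second : hom (mkV vf) (mkV vh) :=
  mkSq (f := mkV vf) (g := mkV vh) (a := g) (b := idm Z)
    (eq_trans (cmp_idl f) (eq_sym e)).

Variables (a : action (mkV vg)) (b : action (mkV vh)).

(** The diagonal filler of [L f] against [h], for the square with top [g] and bottom [R f]. *)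
Definition cmp_mid : hom (fK A (mkV vf)) Y := b ∘ fmap (fK A) cmp_second.

Lemma cmp_mid_fL : cmp_mid ∘ fL A (mkV vf) = g.
Proof.
  unfold cmp_mid; rewrite <- cmp_assoc, fL_nat, cmp_assoc, act_unit.
  apply cmp_idl.
Qed.

Lemma cmp_mid_fR : h ∘ cmp_mid = fR A (mkV vf).
Proof.
  unfold cmp_mid; rewrite cmp_assoc.
  refine (eq_trans (cmp_congl _ (act_over b)) _).
  refine (eq_trans (eq_sym (fR_nat A cmp_second)) _); apply cmp_idl.
Qed.

Definition cmp_sq : hom (Lfun A (mkV vf)) (mkV vg) :=
  mkSq (f := Lfun A (mkV vf)) (g := mkV vg) (a := idm X) (b := cmp_mid)
    (eq_trans cmp_mid_fL (eq_sym (cmp_idr g))).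

Lemma cmp_act_unit :
  a ∘ (fmap (fK A) cmp_sq ∘ delta A (mkV vf)) ∘ fL A (mkV vf) = idm X.
Proof.
  rewrite <- !cmp_assoc, delta_fL.
  refine (eq_trans (cmp_congr _ (fL_nat A cmp_sq)) _).
  rewrite cmp_assoc.
  refine (eq_trans (cmp_congl _ (act_unit a)) _); apply cmp_idl.
Qed.

(** [g ∘ a] is [R g], which naturality turns into [R L f], and [delta] is a section of that. The
    equation also says that the projection to [h] is an algebra morphism. *)
Lemma cmp_act_second :
  g ∘ (a ∘ (fmap (fK A) cmp_sq ∘ delta A (mkV vf))) = cmp_mid.
Proof.
  rewrite cmp_assoc.
  refine (eq_trans (cmp_congl _ (act_over a)) _).
  rewrite cmp_assoc, <- fR_nat, <- cmp_assoc, fR_delta; apply cmp_idr.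
Qed.

Lemma cmp_act_over :
  f ∘ (a ∘ (fmap (fK A) cmp_sq ∘ delta A (mkV vf))) = fR A (mkV vf).
Proof.
  refine (eq_trans (cmp_congl _ (eq_sym e)) _).
  rewrite <- (cmp_assoc h g), cmp_act_second; apply cmp_mid_fR.
Qed.

(* The comonad structure makes [L f] a coalgebra; the composite algebra lifts
   it against [g], the bottom of the lifting problem being itself the lift
   of [L f] against [h]. *)
Definition cmp_action : action (mkV vf) :=
  {| act := a ∘ (fmap (fK A) cmp_sq ∘ delta A (mkV vf))
       : hom (fK A (mkV vf)) (vdom (mkV vf));
     act_unit := cmp_act_unit;
     act_over := cmp_act_over |}.

Lemma cmp_second_mor : act_mor cmp_action b cmp_second.
Proof. exact cmp_act_second. Qed.

(** The counit law [fK_rho_delta] inserts [delta] on the side of [r]; both sides are then [b] after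
    the image of a square from [L f] to [h], and these squares agree. This will give the second
    counit law of the free comonad. *)
Lemma cmp_fold_mor (t : hom (mkV vg) (mkV vh)) (r : hom (mkV vf) (mkV vh)) :
  act_mor a b t -> scod t = h -> sdom r = sdom t -> scod r = idm Z ->
  act_mor cmp_action b r.
Proof.
  intros Ht Htc Hrd Hrc; unfold act_mor.
  rewrite Hrd; cbn [act cmp_action].
  rewrite (cmp_assoc (sdom t) a).
  refine (eq_trans (cmp_congl _ Ht) _).
  rewrite <- cmp_assoc; apply f_equal.
  rewrite <- (cmp_idr (fmap _ r)), <- (fK_rho_delta A (mkV vf)), !cmp_assoc,
    <- !fmap_cmp.
  apply (f_equal (fun z => fmap (fK A) z ∘ _)), sq_eq.
  - exact (cmp_congl _ (eq_sym Hrd)).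
  - change (scod t ∘ cmp_mid = scod r ∘ fR A (mkV vf)).
    rewrite Htc, Hrc; refine (eq_trans cmp_mid_fR (eq_sym (cmp_idl _))).
Qed.

End Composite.

Section Paste.
Variables (X Y Z X' Y' Z' : E) (g : hom X Y) (h : hom Y Z)
  (f : hom X Z) (g' : hom X' Y') (h' : hom Y' Z') (f' : hom X' Z').
Variables (vg : vertical p g) (vh : vertical p h) (vf : vertical p f)
  (vg' : vertical p g') (vh' : vertical p h') (vf' : vertical p f').
Hypotheses (e : h ∘ g = f) (e' : h' ∘ g' = f').
Variables (s : hom (mkV vg) (mkV vg')) (t : hom (mkV vh) (mkV vh')).
Hypothesis (Hst : scod s = sdom t).

Lemma paste_comm : scod t ∘ f = f' ∘ sdom s.
Proof.
  rewrite <- e, <- e', cmp_assoc.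
  refine (eq_trans (f_equal (fun z => z ∘ g) (sq_comm t)) _).
  rewrite <- Hst, <- !cmp_assoc; apply f_equal, (sq_comm s).
Qed.

Definition paste : hom (mkV vf) (mkV vf') :=
  mkSq (f := mkV vf) (g := mkV vf') (a := sdom s) (b := scod t) paste_comm.

(** Functoriality of vertical composition: [paste] commutes with [cmp_second], hence with [cmp_sq]
    because [t] preserves actions, and [delta] is natural. *)
Lemma cmp_action_mor (a : action (mkV vg)) (b : action (mkV vh))
    (a' : action (mkV vg')) (b' : action (mkV vh')) :
  act_mor a a' s -> act_mor b b' t ->
  act_mor (cmp_action vf e a b) (cmp_action vf' e' a' b') paste.
Proof.
  intros Hs Ht.
  assert (Hmid : t ∘ cmp_second vh vf e = cmp_second vh' vf' e' ∘ paste).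
  { apply sq_eq.
    - change (sdom t ∘ g = g' ∘ sdom s); rewrite <- Hst; exact (sq_comm s).
    - exact (eq_trans (cmp_idr _) (eq_sym (cmp_idl _))). }
  assert (Hsq : s ∘ cmp_sq vg vf e b
                = cmp_sq vg' vf' e' b' ∘ fmap (Lfun A) paste).
  { apply sq_eq.
    - exact (eq_trans (cmp_idr _) (eq_sym (cmp_idl _))).
    - change (scod s ∘ cmp_mid vf e b
              = cmp_mid vf' e' b' ∘ fmap (fK A) paste).
      unfold cmp_mid; rewrite Hst, cmp_assoc.
      refine (eq_trans (cmp_congl _ Ht) _).
      rewrite <- !cmp_assoc, <- !fmap_cmp; apply f_equal, f_equal, Hmid. }
  unfold act_mor; cbn [act cmp_action].
  rewrite (cmp_assoc (sdom paste) a).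
  refine (eq_trans (cmp_congl _ Hs) _).
  rewrite <- !cmp_assoc; apply f_equal.
  rewrite delta_nat, !cmp_assoc, <- !fmap_cmp, Hsq; reflexivity.
Qed.

End Paste.

(** Naturality and coassociativity of [delta] bring the left side to the form [a], a square, one
    [delta], as on the right. It remains to compare two squares from [L f] to [g]. *)
Lemma cmp_action_assoc (W X Y Z : E) (g : hom W X) (h : hom X Y) (k : hom Y Z)
    (hg : hom W Y) (kh : hom X Z) (f : hom W Z)
    (vg : vertical p g) (vh : vertical p h) (vk : vertical p k)
    (vhg : vertical p hg) (vkh : vertical p kh) (vf : vertical p f)
    (e1 : h ∘ g = hg) (e2 : k ∘ h = kh) (e3 : k ∘ hg = f) (e4 : kh ∘ g = f)
    (a : action (mkV vg)) (b : action (mkV vh)) (c : action (mkV vk)) :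
  act (cmp_action vf e3 (cmp_action vhg e1 a b) c)
  = act (cmp_action vf e4 a (cmp_action vkh e2 b c)).
Proof.
  cbn [act cmp_action]; rewrite <- !cmp_assoc; apply f_equal.
  rewrite (cmp_assoc (delta A _)), delta_nat, <- cmp_assoc, delta_coassoc,
    !cmp_assoc, <- !fmap_cmp.
  apply (f_equal (fun z => fmap (fK A) z ∘ _)), sq_eq.
  - change (idm W ∘ idm W ∘ sdom (Sig A (mkV vf)) = idm W).
    rewrite Sig_dom, cmp_idl; apply cmp_idl.
  (* On codomains both sides are [b] applied to a lift of [L f]; naturality of [delta] again reduces
     this to an equality of squares, now into [h]. *)
  - change (cmp_mid vhg e1 b ∘ fmap (fK A) (cmp_sq vhg vf e3 c)
              ∘ delta A (mkV vf)
            = cmp_mid vf e4 (cmp_action vkh e2 b c)).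
    unfold cmp_mid at 2; cbn [act cmp_action].
    rewrite <- !cmp_assoc, delta_nat; unfold cmp_mid.
    rewrite <- cmp_assoc; apply f_equal.
    rewrite !cmp_assoc, <- !fmap_cmp.
    apply (f_equal (fun z => fmap (fK A) z ∘ _)), sq_eq.
    + exact (eq_trans (cmp_idr _) (eq_sym (cmp_idl _))).
    + change (idm Y ∘ cmp_mid vf e3 c
              = cmp_mid vkh e2 c ∘ fmap (fK A) (cmp_second vkh vf e4)).
      unfold cmp_mid; rewrite cmp_idl, <- cmp_assoc, <- fmap_cmp.
      apply f_equal, f_equal, sq_eq.
      * exact (eq_sym e1).
      * exact (eq_sym (cmp_idl _)).
Qed.

End Actions.

(** The universal property ranges over squares [s] with arbitrary codomain component, not just those
    of the fibre. [fr_rl] keeps the identity so that it is literally a commuting square. *)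
Record free_action (E B : Category) (p : Functor E B) (A : Lawfs p)
    (f : V p) := {
  fr_ob : E;
  fr_l : hom (vdom f) fr_ob;
  fr_r : hom fr_ob (vcod f);
  fr_vert : vertical p fr_r;
  fr_rl : idm (vcod f) ∘ vmap f = fr_r ∘ fr_l;
  fr_act : action A (mkV fr_vert);
  fr_univ : forall (g : V p) (a : action A g) (s : hom f g),
    exists! t : hom (mkV fr_vert) g,
      act_mor fr_act a t /\
      t ∘ mkSq (f := f) (g := mkV fr_vert) (a := fr_l) (b := idm (vcod f))
            fr_rl
      = s
}.

(** * Passage between pointed algebras and actions *)

Section PointedAlgebras.
Variables (E B : Category) (p : Functor E B) (A : Lawfs p).

(** [lam] has identity codomain components, so the unit law leaves no choice. *)
Lemma palg_act_cod (x : PAlg (lam A)) :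
  scod (palg_act x) = idm (vcod (palg_ob x)).
Proof.
  refine (eq_trans (eq_sym (cmp_idr _)) _).
  exact (f_equal (fun s => scod s) (palg_unit x)).
Qed.

Lemma action_of_palg_over (x : PAlg (lam A)) :
  vmap (palg_ob x) ∘ sdom (palg_act x) = fR A (palg_ob x).
Proof.
  refine (eq_trans (eq_sym (sq_comm (palg_act x))) _).
  refine (eq_trans (cmp_congl _ (palg_act_cod x)) _); apply cmp_idl.
Qed.

Definition action_of_palg (x : PAlg (lam A)) : action A (palg_ob x) :=
  {| act := sdom (palg_act x);
     act_unit := f_equal (fun s => sdom s) (palg_unit x);
     act_over := action_of_palg_over x |}.

Definition sq_of_action (g : V p) (a : action A g) : hom (Rfun A g) g :=
  mkSq (f := Rfun A g) (g := g) (a := act a) (b := idm (vcod g))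
    (eq_trans (cmp_idl _) (eq_sym (act_over a))).

Lemma palg_of_action_unit (g : V p) (a : action A g) :
  sq_of_action a ∘ lam A g = idm g.
Proof. apply sq_eq; [apply act_unit | apply cmp_idl]. Qed.

Definition palg_of_action (g : V p) (a : action A g) : PAlg (lam A) :=
  {| palg_ob := g; palg_act := sq_of_action a;
     palg_unit := palg_of_action_unit a |} : PAlgOb (lam A).

Lemma act_mor_of_palg (x y : PAlg (lam A)) (s : hom x y) :
  act_mor (action_of_palg x) (action_of_palg y) (palg_hom s).
Proof. exact (f_equal (fun s => sdom s) (palg_hom_act s)). Qed.

Lemma palg_hom_of_act_mor (x y : PAlg (lam A))
    (s : hom (palg_ob x) (palg_ob y)) :
  act_mor (action_of_palg x) (action_of_palg y) s ->
  s ∘ palg_act x = palg_act y ∘ fmap (Rfun A) s.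
Proof.
  intros Hs; apply sq_eq; [exact Hs|].
  change (scod s ∘ scod (palg_act x) = scod (palg_act y) ∘ scod s).
  rewrite !palg_act_cod; exact (eq_trans (cmp_idr _) (eq_sym (cmp_idl _))).
Qed.

End PointedAlgebras.

(** * Pullback of algebras, and free algebras from fibrewise initial objects *)

Section FreeFromFibres.
Variables (E B : Category) (p : Functor E B) (cl : Cleavage p).
Hypothesis Hlim : has_all_finite_limits cl.
Variable A : Lawfs p.

(** The last two clauses make [c] cartesian over [u], first for squares and then for algebra
    morphisms. *)
Lemma action_pullback (Y : E) (g : V p) (a : action A g) (u : hom Y (vcod g)) :
  exists (P : E) (g' : hom P Y) (vg' : vertical p g') (a' : action A (mkV vg'))
    (c : hom (mkV vg') g),
    scod c = u /\ act_mor a' a c /\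
    (forall (f : V p) (s : hom f g) (w : hom (vcod f) Y), scod s = u ∘ w ->
       exists! t : hom f (mkV vg'), scod t = w /\ c ∘ t = s) /\
    (forall (f : V p) (b : action A f) (t : hom f (mkV vg')),
       act_mor b a (c ∘ t) -> act_mor b a' t).
Proof.
  destruct (vertical_pullback Hlim u (fs_prop g : vertical p (vmap g)))
    as (P & g' & u' & vg' & Hsq & Huniv).
  assert (Hmono : forall W (t t' : hom W P),
    g' ∘ t = g' ∘ t' -> u' ∘ t = u' ∘ t' -> t = t').
  { intros W t t' H1 H2.
    destruct (Huniv W (g' ∘ t') (u' ∘ t')) as (t0 & _ & H).
    { rewrite !cmp_assoc; now rewrite Hsq. }
    rewrite <- (H t (conj H1 H2)); apply H; now split. }
  pose (c := mkSq (f := mkV vg') (g := g) (a := u') (b := u) Hsq).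
  (* The new action is induced by the pullback: one projection must be [R g'] for [act_over], the
     other is forced if [c] is to preserve actions. *)
  destruct (Huniv (fK A (mkV vg')) (fR A (mkV vg')) (a ∘ fmap (fK A) c))
    as (a' & [Ha1 Ha2] & _).
  { rewrite cmp_assoc, act_over; exact (fR_nat A c). }
  assert (Hunit : a' ∘ fL A (mkV vg') = idm P).
  { apply Hmono.
    - rewrite cmp_assoc, Ha1, cmp_idr; exact (fRL A (mkV vg')).
    - rewrite cmp_assoc, Ha2, <- cmp_assoc, fL_nat, cmp_assoc, act_unit,
        cmp_idr.
      apply cmp_idl. }
  exists P, g', vg', (@Build_action _ _ p A (mkV vg') a' Hunit Ha1), c.
  split; [reflexivity | split; [exact Ha2 | split]].
  - intros f s w Hs.
    destruct (Huniv (vdom f) (w ∘ vmap f) (sdom s)) as (t & [Ht1 Ht2] & Hu).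
    { rewrite cmp_assoc, <- Hs; exact (sq_comm s). }
    exists (mkSq (f := f) (g := mkV vg') (eq_sym Ht1)); split; [split|].
    + reflexivity.
    + apply sq_eq; [exact Ht2 | exact (eq_sym Hs)].
    + intros t' [H1 H2]; apply sq_eq; [|exact (eq_sym H1)].
      apply Hu; split.
      * refine (eq_trans (eq_sym (sq_comm t')) _); now rewrite H1.
      * exact (f_equal (fun s => sdom s) H2).
  - intros f b t Ht; apply Hmono.
    + rewrite !cmp_assoc.
      refine (eq_trans (cmp_congl _ (eq_sym (sq_comm t))) _).
      refine (eq_trans _ (cmp_congl _ (eq_sym Ha1))).
      rewrite <- cmp_assoc, act_over; exact (fR_nat A t).
    + rewrite !cmp_assoc.
      refine (eq_trans Ht _).
      refine (eq_trans _ (cmp_congl _ (eq_sym Ha2))).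
      now rewrite <- cmp_assoc, <- fmap_cmp.
Qed.

(** Pulling the target back along [scod s] turns [s] into a fibre morphism [s']; initiality extends
    [s'], and composing with [c] extends [s]. *)
Lemma free_action_of_initial (X Y : E) (f : hom X Y) (vf : vertical p f)
    (i : Initial (Comma (fibre_vert vf)
           (fib_restrict (palg_forget (lam A)) (cod_functor p) Y))) :
  inhabited (free_action A (mkV vf)).
Proof.
  destruct i as [[[x ex] [l Hl]] Hin].
  destruct x as [[[K Y0 r] vr] al Hal]; cbn in ex.
  (* The codomain of the initial algebra equals [Y] only propositionally; from here on [Y] is
     replaced by [Y0]. *)
  destruct ex; change (vertical p r) in vr.
  change (@hom (V p) (mkV vf) (mkV vr)) in l.
  pose (x := @Build_PAlgOb _ _ (lam A) (mkV vr) al Hal : PAlg (lam A)).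
  pose proof (arr_eq_eq Hl : scod l = idm Y0) as Hl'.
  assert (Hrl : idm Y0 ∘ f = r ∘ sdom l).
  { rewrite <- Hl'; exact (sq_comm l). }
  assert (Hlsq : mkSq (f := mkV vf) (g := mkV vr) (a := sdom l) (b := idm Y0)
                   Hrl = l).
  { apply sq_eq; [reflexivity | exact (eq_sym Hl')]. }
  assert (Hu : forall (g : V p) (a : action A g) (s : hom (mkV vf) g),
    exists! t : hom (mkV vr) g, act_mor (action_of_palg x) a t /\ t ∘ l = s).
  2: { constructor; rewrite <- Hlsq in Hu.
       exact {| fr_ob := K; fr_l := sdom l; fr_r := r; fr_vert := vr;
                fr_rl := Hrl; fr_act := action_of_palg x; fr_univ := Hu |}. }
  intros g a s.
  destruct (action_pullback a (scod s))
    as (P & g' & vg' & a' & c & Hc & Hca & Hcu & Hcm).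
  destruct (Hcu (mkV vf) s (idm Y0) (eq_sym (cmp_idr _)))
    as (s' & [Hs1 Hs2] & Hs3).
  pose (z1 := {| fib_ob := palg_of_action a'; fib_eq := eq_refl |}
    : Fib (cod_functor p ⊚ palg_forget (lam A)) Y0).
  assert (Hs' : arr_eq (fmap (cod_functor p) s') (idm Y0)).
  { exact (eq_ind_r (fun z => arr_eq z (idm Y0)) (arr_eq_refl (idm Y0)) Hs1). }
  pose (U := fib_restrict (palg_forget (lam A)) (cod_functor p) Y0).
  pose (x1 := {| fib_ob := x; fib_eq := eq_refl |}
    : Fib (cod_functor p ⊚ palg_forget (lam A)) Y0).
  pose (y := @Build_CommaOb _ _ (fibre_vert vf) U x1
    (@Build_FibHom _ _ (cod_functor p) Y0 (fibre_vert vf) (U x1) l Hl)).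
  pose (z := @Build_CommaOb _ _ (fibre_vert vf) U z1
    (@Build_FibHom _ _ (cod_functor p) Y0 (fibre_vert vf) (U z1) s' Hs')).
  pose (und := fun k : CommaHom y z =>
    palg_hom (fib_hom (comma_hom k : FibHom x1 z1)
              : PAlgHom x (palg_of_action a')) : hom (mkV vr) (mkV vg')).
  destruct (Hin z) as (h & _ & Hh).
  (* Uniqueness of the initial map, restated for plain squares over the identity. *)
  assert (Hex : forall t' : hom (mkV vr) (mkV vg'), scod t' = idm Y0 ->
    act_mor (action_of_palg x) a' t' -> t' ∘ l = s' -> t' = und h).
  { intros t' H1 H2 H3.
    pose (k0 := @Build_PAlgHom _ _ (lam A) x (palg_of_action a') t'
                  (palg_hom_of_act_mor (y := palg_of_action a') H2)
                : @hom (PAlg (lam A)) x (palg_of_action a')).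
    assert (Hk0 : arr_eq (fmap (cod_functor p ⊚ palg_forget (lam A)) k0)
                    (idm Y0)).
    { exact (eq_ind_r (fun z => arr_eq z (idm Y0)) (arr_eq_refl (idm Y0)) H1). }
    pose (k1 := @Build_FibHom _ _ (cod_functor p ⊚ palg_forget (lam A)) Y0
                  x1 z1 k0 Hk0).
    unshelve epose (k := @Build_CommaHom _ _ (fibre_vert vf) U y z k1 _).
    { apply FibHom_eq; exact H3. }
    exact (f_equal und (eq_sym (Hh k I))). }
  pose proof (f_equal (@fib_hom _ _ _ _ _ _) (comma_tri h)) as Htri.
  exists (c ∘ und h); split; [split|].
  - refine (act_mor_cmp Hca _).
    exact (act_mor_of_palg (fib_hom (comma_hom h : FibHom x1 z1)
                            : @hom (PAlg (lam A)) x (palg_of_action a'))).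
  - rewrite <- cmp_assoc; refine (eq_trans (f_equal (fun z => c ∘ z) Htri) Hs2).
  - intros t [Ht1 Ht2].
    (* Because [l] is over the identity, [t] lies over the same map as [s], so it too factors
       through [c]. *)
    assert (Htc : scod t = scod s ∘ idm Y0).
    { rewrite <- Ht2, cmp_idr; refine (eq_trans (eq_sym (cmp_idr _)) _).
      exact (f_equal (fun z => scod t ∘ z) (eq_sym Hl')). }
    destruct (Hcu (mkV vr) t (idm Y0) Htc) as (t' & [Ht'1 Ht'2] & _).
    rewrite <- Ht'2; apply f_equal, eq_sym, Hex; [exact Ht'1 | | ].
    + apply Hcm.
      exact (eq_ind_r (fun z => act_mor (action_of_palg x) a z) Ht1 Ht'2).
    + symmetry; apply Hs3; split.
      * refine (eq_trans (cmp_congl _ Ht'1) _).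
        refine (eq_trans (cmp_idl _) Hl').
      * rewrite cmp_assoc; exact (eq_trans (f_equal (fun z => z ∘ l) Ht'2) Ht2).
Qed.

End FreeFromFibres.

(** * The free factorisation and its monad *)

Section FreeAwfs.
Variables (E B : Category) (p : Functor E B) (A : Lawfs p).
Variable fr : forall f : V p, free_action A f.

Definition free_unit (f : V p) : hom f (mkV (fr_vert (fr f))) :=
  mkSq (f := f) (g := mkV (fr_vert (fr f))) (fr_rl (fr f)).

Definition ext (f g : V p) (a : action A g) (s : hom f g) :
    hom (mkV (fr_vert (fr f))) g :=
  proj1_sig (constructive_definite_description _ (fr_univ (fr f) a s)).

Lemma ext_mor (f g : V p) (a : action A g) (s : hom f g) :
  act_mor (fr_act (fr f)) a (ext a s).
Proof.
  exact (proj1 (proj2_sig (constructive_definite_description _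
                                (fr_univ (fr f) a s)))).
Qed.

Lemma ext_unit (f g : V p) (a : action A g) (s : hom f g) :
  ext a s ∘ free_unit f = s.
Proof.
  exact (proj2 (proj2_sig (constructive_definite_description _
                                (fr_univ (fr f) a s)))).
Qed.

Lemma ext_dom (f g : V p) (a : action A g) (s : hom f g) :
  sdom (ext a s) ∘ fr_l (fr f) = sdom s.
Proof. exact (f_equal (fun s => sdom s) (ext_unit a s)). Qed.

Lemma ext_cod (f g : V p) (a : action A g) (s : hom f g) :
  scod (ext a s) = scod s.
Proof.
  refine (eq_trans (eq_sym (cmp_idr _)) _).
  exact (f_equal (fun s => scod s) (ext_unit a s)).
Qed.

(** Uniqueness in [fr_univ], split into components. All later laws rest on it: both sides are
    exhibited as algebra morphisms and compared on the unit. *)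
Lemma free_eq (f g : V p) (a : action A g)
    (t t' : hom (mkV (fr_vert (fr f))) g) :
  act_mor (fr_act (fr f)) a t -> act_mor (fr_act (fr f)) a t' ->
  sdom t ∘ fr_l (fr f) = sdom t' ∘ fr_l (fr f) -> scod t = scod t' -> t = t'.
Proof.
  intros H H' Hd Hc.
  destruct (fr_univ (fr f) a (t' ∘ free_unit f)) as (t0 & _ & Hu).
  rewrite <- (Hu t), <- (Hu t'); [reflexivity | now split | split; [exact H|]].
  apply sq_eq; [exact Hd | exact (cmp_congl _ Hc)].
Qed.

Definition free_map (f g : V p) (s : hom f g) :
    hom (mkV (fr_vert (fr f))) (mkV (fr_vert (fr g))) :=
  ext (fr_act (fr g)) (free_unit g ∘ s).

Lemma free_map_cod (f g : V p) (s : hom f g) : scod (free_map s) = scod s.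
Proof.
  exact (eq_trans (ext_cod (fr_act (fr g)) (free_unit g ∘ s))
           (cmp_idl (scod s))).
Qed.

Lemma free_map_dom (f g : V p) (s : hom f g) :
  sdom (free_map s) ∘ fr_l (fr f) = fr_l (fr g) ∘ sdom s.
Proof. exact (ext_dom _ _). Qed.

Lemma free_map_id (f : V p) : free_map (idm f) = idm _.
Proof.
  apply (free_eq (a := fr_act (fr f))).
  - apply ext_mor.
  - apply act_mor_id.
  - refine (eq_trans (free_map_dom (idm f)) _).
    exact (eq_trans (cmp_idr _) (eq_sym (cmp_idl _))).
  - exact (free_map_cod (idm f)).
Qed.

Lemma free_map_cmp (f g h : V p) (t : hom g h) (s : hom f g) :
  free_map (t ∘ s) = free_map t ∘ free_map s.
Proof.
  apply (free_eq (a := fr_act (fr h))).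
  - apply ext_mor.
  - eapply act_mor_cmp; apply ext_mor.
  - refine (eq_trans (free_map_dom (t ∘ s)) _).
    change (fr_l (fr h) ∘ (sdom t ∘ sdom s)
            = sdom (free_map t) ∘ sdom (free_map s) ∘ fr_l (fr f)).
    rewrite <- (cmp_assoc (sdom (free_map t))).
    now rewrite free_map_dom, !cmp_assoc, free_map_dom.
  - refine (eq_trans (free_map_cod (t ∘ s)) _).
    change (scod t ∘ scod s = scod (free_map t) ∘ scod (free_map s)).
    now rewrite !free_map_cod.
Qed.

Definition free_K : Functor (V p) E :=
  {| fob := fun f : V p => fr_ob (fr f) : E;
     fmap := fun f g s => sdom (free_map s);
     fmap_id := fun f => f_equal (fun s => sdom s) (free_map_id f);
     fmap_cmp := fun f g h t s =>
       f_equal (fun s => sdom s) (free_map_cmp t s) |}.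

Lemma free_vert_l (f : V p) : vertical p (fr_l (fr f)).
Proof.
  apply (vertical_cancel (fr_vert (fr f))).
  rewrite <- fr_rl, cmp_idl; apply (fs_prop f).
Qed.

Lemma free_R_nat (f g : V p) (s : hom f g) :
  scod s ∘ fr_r (fr f) = fr_r (fr g) ∘ sdom (free_map s).
Proof. rewrite <- free_map_cod; exact (sq_comm (free_map s)). Qed.

Definition free_fact : FFact p :=
  {| fK := free_K;
     fL := fun f => fr_l (fr f);
     fR := fun f => fr_r (fr f);
     fL_vert := free_vert_l;
     fR_vert := fun f => fr_vert (fr f);
     fL_nat := free_map_dom;
     fR_nat := free_R_nat;
     fRL := fun f => eq_trans (eq_sym (fr_rl (fr f))) (cmp_idl _) |}.

Notation F := free_fact.
Notation R := (Rfun F).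
Notation L := (Lfun F).
Notation "'α' f" := (fr_act (fr f) : action A (R f)) (at level 10).

(** [fmap R s] has codomain component [scod s] by definition, [free_map s] only up to a proof, hence
    the transfer along [act_mor_eq]. *)
Lemma R_mor (f g : V p) (s : hom f g) : act_mor (α f) (α g) (fmap R s).
Proof.
  apply act_mor_eq with (s := free_map s);
    [reflexivity | exact (free_map_cod s) | apply ext_mor].
Qed.

Lemma ext_lam (f g : V p) (a : action A g) (s : hom f g) :
  (ext a s : hom (R f) g) ∘ lam F f = s.
Proof.
  apply sq_eq; [apply ext_dom | exact (eq_trans (cmp_idr _) (ext_cod a s))].
Qed.

(** The counit of the free-algebra adjunction at the free algebra on [f]. *)
Definition free_mult (f : V p) : hom (R (R f)) (R f) := ext (α f) (idm (R f)).

Lemma free_mult_mor f : act_mor (α (R f)) (α f) (free_mult f).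
Proof. apply ext_mor. Qed.

Lemma free_mult_dom f : sdom (free_mult f) ∘ fL F (R f) = idm (fK F f).
Proof. exact (ext_dom _ _). Qed.

Lemma free_mult_cod f : scod (free_mult f) = idm (vcod f).
Proof. exact (ext_cod _ _). Qed.

Lemma free_mult_unit f : free_mult f ∘ lam F (R f) = idm (R f).
Proof. exact (ext_lam _ _). Qed.

Lemma free_eq_lam (f g : V p) (a : action A g) (t t' : hom (R f) g) :
  act_mor (α f) a t -> act_mor (α f) a t' -> t ∘ lam F f = t' ∘ lam F f ->
  t = t'.
Proof.
  intros H H' Heq; apply (free_eq H H').
  - exact (f_equal (fun s => sdom s) Heq).
  - pose proof (f_equal (fun s => scod s) Heq) as Hc.
    exact (eq_trans (eq_sym (cmp_idr _)) (eq_trans Hc (cmp_idr _))).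
Qed.

Lemma free_mult_nat (f g : V p) (s : hom f g) :
  free_mult g ∘ fmap R (fmap R s) = fmap R s ∘ free_mult f.
Proof.
  apply (free_eq_lam (a := α g)).
  - exact (act_mor_cmp (free_mult_mor g) (R_mor _)).
  - exact (act_mor_cmp (R_mor _) (free_mult_mor f)).
  - rewrite <- !cmp_assoc, free_mult_unit, cmp_idr.
    rewrite <- (nt_nat (lam F) (fmap R s)), cmp_assoc, free_mult_unit.
    apply cmp_idl.
Qed.

Definition free_Pi : NatTrans (R ⊚ R) R :=
  @Build_NatTrans _ _ (R ⊚ R) R free_mult free_mult_nat.

Lemma free_monad : is_monad (lam F) free_Pi.
Proof.
  split; [exact free_mult_unit | split].
  - intros f; apply (free_eq_lam (a := α f)).
    + exact (act_mor_cmp (free_mult_mor f) (R_mor _)).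
    + apply act_mor_id.
    + rewrite <- cmp_assoc.
      refine (eq_trans (cmp_congr _ (eq_sym (nt_nat (lam F) (lam F f)))) _).
      rewrite cmp_assoc; refine (cmp_congl _ (free_mult_unit f)).
  - intros f; apply (free_eq_lam (a := α f)).
    + exact (act_mor_cmp (free_mult_mor f) (R_mor _)).
    + exact (act_mor_cmp (free_mult_mor f) (free_mult_mor _)).
    + rewrite <- !cmp_assoc.
      refine (eq_trans (cmp_congr _ (eq_sym (nt_nat (lam F) (free_mult f)))) _).
      refine (eq_trans _ (cmp_congr _ (eq_sym (free_mult_unit (R f))))).
      rewrite cmp_assoc; refine (eq_trans (cmp_congl _ (free_mult_unit f)) _).
      exact (eq_trans (cmp_idl _) (eq_sym (cmp_idr _))).
Qed.

(** * The comonad of the free factorisation *)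

Definition RRL (f : V p) : V p :=
  mkV (vertical_cmp (fR_vert F (L f)) (fR_vert F f)).

Definition RRL_act (f : V p) : action A (RRL f) :=
  cmp_action _ eq_refl (α (L f)) (α f).

Lemma RRL_unit_comm (f : V p) :
  idm (vcod f) ∘ vmap f = vmap (RRL f) ∘ fL F (L f).
Proof.
  change (idm (vcod f) ∘ vmap f = fR F f ∘ fR F (L f) ∘ fL F (L f)).
  rewrite <- cmp_assoc, fRL, cmp_idl; symmetry; exact (fRL F f).
Qed.

(** Its domain component is the map of [L (L f)], which forces the comultiplication to lie over
    [dom]. *)
Definition RRL_unit (f : V p) : hom f (RRL f) :=
  mkSq (f := f) (g := RRL f) (RRL_unit_comm f).

Definition free_diag (f : V p) : hom (R f) (RRL f) :=
  ext (RRL_act f) (RRL_unit f).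

Lemma free_diag_mor f : act_mor (α f) (RRL_act f) (free_diag f).
Proof. apply ext_mor. Qed.

Lemma free_diag_cod f : scod (free_diag f) = idm (vcod f).
Proof. exact (ext_cod _ _). Qed.

Definition free_delta (f : V p) : hom (fK F f) (fK F (L f)) :=
  sdom (free_diag f).

Lemma free_delta_fL f : free_delta f ∘ fL F f = fL F (L f).
Proof. exact (ext_dom (RRL_act f) (RRL_unit f)). Qed.

Lemma free_delta_comm f :
  free_delta f ∘ vmap (L f) = vmap (L (L f)) ∘ idm (vdom f).
Proof. rewrite cmp_idr; exact (free_delta_fL f). Qed.

Definition free_comult (f : V p) : hom (L f) (L (L f)) :=
  mkSq (f := L f) (g := L (L f)) (free_delta_comm f).

Lemma free_comult_nat (f g : V p) (s : hom f g) :
  free_comult g ∘ fmap L s = fmap L (fmap L s) ∘ free_comult f.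
Proof.
  apply sq_eq; [exact (eq_trans (cmp_idl _) (eq_sym (cmp_idr _)))|].
  (* The right side of the goal is the domain component of [q] after [free_diag f]; as a pasting of
     algebra morphisms, [q] preserves the composite actions. *)
  pose (q := paste (vertical_cmp (fR_vert F (L f)) (fR_vert F f))
    (vertical_cmp (fR_vert F (L g)) (fR_vert F g)) eq_refl eq_refl
    (s := fmap R (fmap L s)) (t := fmap R s) eq_refl : hom (RRL f) (RRL g)).
  refine (f_equal (fun t => sdom t)
            (_ : free_diag g ∘ fmap R s = q ∘ free_diag f)).
  apply (free_eq (a := RRL_act g)).
  - exact (act_mor_cmp (free_diag_mor g) (R_mor s)).
  - refine (act_mor_cmp _ (free_diag_mor f)).
    exact (cmp_action_mor _ _ _ _ _ (R_mor (fmap L s)) (R_mor s)).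
  - change (free_delta g ∘ fmap (fK F) s ∘ fL F f
            = fmap (fK F) (fmap L s) ∘ free_delta f ∘ fL F f).
    rewrite <- !cmp_assoc, free_delta_fL, fL_nat, cmp_assoc, free_delta_fL.
    symmetry; exact (fL_nat F (fmap L s)).
  - change (scod (free_diag g) ∘ scod s = scod s ∘ scod (free_diag f)).
    rewrite !free_diag_cod, cmp_idr; apply cmp_idl.
Qed.

Definition free_Sig : NatTrans L (L ⊚ L) :=
  @Build_NatTrans _ _ L (L ⊚ L) free_comult free_comult_nat.

(** Projecting the composite algebra onto its second factor [R f] is an algebra morphism, and after
    [free_diag f] it fixes the unit. *)
Lemma fR_free_delta f : fR F (L f) ∘ free_delta f = idm (fK F f).
Proof.
  pose (q := cmp_second (fR_vert F f)
    (vertical_cmp (fR_vert F (L f)) (fR_vert F f)) eq_refl : hom (RRL f) (R f)).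
  refine (f_equal (fun t => sdom t) (_ : q ∘ free_diag f = idm (R f))).
  apply (free_eq (a := α f)).
  - exact (act_mor_cmp (cmp_second_mor _ _ _ _) (free_diag_mor f)).
  - apply act_mor_id.
  - change (fR F (L f) ∘ free_delta f ∘ fL F f = idm _ ∘ fL F f).
    rewrite <- cmp_assoc, free_delta_fL, cmp_idl; exact (fRL F (L f)).
  - exact (eq_trans (cmp_idl _) (free_diag_cod f)).
Qed.

Lemma rho_fold_comm f :
  idm (vcod f) ∘ vmap (RRL f) = vmap (R f) ∘ fmap (fK F) (rho F f).
Proof.
  refine (eq_trans (cmp_idl _) _); exact (fR_nat F (rho F f)).
Qed.

(** Here the composite algebra is folded onto [R f]: [cmp_fold_mor] applies to [R (rho f)], whose
    codomain component is the map of [R f]. *)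
Lemma rho_free_delta f : fmap (fK F) (rho F f) ∘ free_delta f = idm (fK F f).
Proof.
  pose (q := mkSq (f := RRL f) (g := R f) (rho_fold_comm f)).
  refine (f_equal (fun t => sdom t) (_ : q ∘ free_diag f = idm (R f))).
  apply (free_eq (a := α f)).
  - refine (act_mor_cmp _ (free_diag_mor f)).
    exact (cmp_fold_mor eq_refl (r := q) (R_mor (rho F f))
             eq_refl eq_refl eq_refl).
  - apply act_mor_id.
  - change (fmap (fK F) (rho F f) ∘ free_delta f ∘ fL F f = idm _ ∘ fL F f).
    rewrite <- cmp_assoc, free_delta_fL, cmp_idl.
    refine (eq_trans (fL_nat F (rho F f)) (cmp_idr _)).
  - exact (eq_trans (cmp_idl _) (free_diag_cod f)).
Qed.

(** Both sides come from algebra morphisms from [R f] to the triple composite of [R (L (L f))],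
    [R (L f)] and [R f]. The two pastings bracket its action differently, which [cmp_action_assoc]
    reconciles. *)
Lemma free_delta_coassoc f :
  fmap (fK F) (free_comult f) ∘ free_delta f = free_delta (L f) ∘ free_delta f.
Proof.
  pose (vL := fR_vert F (L f)); pose (vLL := fR_vert F (L (L f))).
  pose (v3 := vertical_cmp (vertical_cmp vLL vL) (fR_vert F f)).
  pose (q := paste (vertical_cmp vL (fR_vert F f)) v3
    eq_refl (eq_sym (cmp_assoc _ _ _))
    (s := fmap R (free_comult f)) (t := free_diag f) eq_refl).
  pose (q' := paste (vertical_cmp vL (fR_vert F f)) v3
    eq_refl eq_refl (s := free_diag (L f)) (t := idm (R f))
    (free_diag_cod (L f))).
  refine (f_equal (fun t => sdom t) (_ : q ∘ free_diag f = q' ∘ free_diag f)).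
  pose (a3 := cmp_action v3 eq_refl (RRL_act (L f)) (α f)).
  apply (free_eq (a := a3)).
  - refine (act_mor_cmp _ (free_diag_mor f)).
    unfold act_mor, a3, RRL_act at 2.
    rewrite (cmp_action_assoc _ (vertical_cmp vL (fR_vert F f)) _ _ eq_refl _
               (eq_sym (cmp_assoc _ _ _))).
    exact (cmp_action_mor _ _ _ _ _ (R_mor (free_comult f)) (free_diag_mor f)).
  - refine (act_mor_cmp _ (free_diag_mor f)).
    exact (cmp_action_mor _ _ _ _ _ (free_diag_mor (L f)) (act_mor_id _)).
  - change (fmap (fK F) (free_comult f) ∘ free_delta f ∘ fL F f
            = free_delta (L f) ∘ free_delta f ∘ fL F f).
    rewrite <- !cmp_assoc, free_delta_fL.
    refine (eq_trans (fL_nat F (free_comult f)) (eq_trans (cmp_idr _) _)).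
    symmetry; exact (free_delta_fL (L f)).
  - change (scod (free_diag f) ∘ scod (free_diag f)
            = idm _ ∘ scod (free_diag f)).
    now rewrite free_diag_cod.
Qed.

Lemma free_comonad : is_comonad (rho F) free_Sig.
Proof.
  repeat split; intros f; apply sq_eq.
  - apply cmp_idl.
  - exact (fR_free_delta f).
  - apply cmp_idl.
  - exact (rho_free_delta f).
  - reflexivity.
  - exact (free_delta_coassoc f).
Qed.

Definition free_lawfs : Lawfs p :=
  {| Sig := free_Sig; Sig_dom := fun f => eq_refl;
     Sig_comonad := free_comonad |}.

(** * The distributive law *)

Notation law := (canonical_law (A := free_lawfs) free_monad).

Lemma free_delta_mult f :
  free_delta f ∘ sdom (free_mult f)
  = sdom (free_mult (L f)) ∘ fmap (fK F) (law f) ∘ free_delta (R f).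
Proof.
  (* The codomain component of [law f] is the domain component of [free_mult f], so [s] and
     [free_mult f] can be pasted. *)
  pose (s := free_mult (L f) ∘ fmap R (law f)).
  assert (Hs : scod s = sdom (free_mult f)).
  { change (scod (free_mult (L f)) ∘ sdom (free_mult f) = sdom (free_mult f)).
    rewrite free_mult_cod; apply cmp_idl. }
  pose (q := paste (vertical_cmp (fR_vert F (L (R f))) (fR_vert F (R f)))
    (vertical_cmp (fR_vert F (L f)) (fR_vert F f)) eq_refl eq_refl
    (s := s) (t := free_mult f) Hs : hom (RRL (R f)) (RRL f)).
  refine (f_equal (fun t => sdom t)
            (_ : free_diag f ∘ free_mult f = q ∘ free_diag (R f))).
  apply (free_eq (a := RRL_act f)).
  - exact (act_mor_cmp (free_diag_mor f) (free_mult_mor f)).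
  - refine (act_mor_cmp _ (free_diag_mor (R f))).
    exact (cmp_action_mor _ _ _ _ _
             (act_mor_cmp (free_mult_mor (L f)) (R_mor (law f))) (free_mult_mor f)).
  - change (free_delta f ∘ sdom (free_mult f) ∘ fL F (R f)
      = sdom (free_mult (L f)) ∘ fmap (fK F) (law f) ∘ free_delta (R f)
          ∘ fL F (R f)).
    rewrite <- !cmp_assoc, free_mult_dom, free_delta_fL, cmp_idr.
    refine (eq_trans _ (cmp_congr _ (eq_sym (fL_nat F (law f))))).
    rewrite cmp_assoc.
    refine (eq_trans _ (cmp_congl _ (eq_sym (free_mult_dom (L f))))).
    symmetry; apply cmp_idl.
  - change (scod (free_diag f) ∘ scod (free_mult f)
            = scod (free_mult f) ∘ scod (free_diag (R f))).
    now rewrite !free_diag_cod, free_mult_cod.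
Qed.

(** [free_delta_mult] serves twice: as the domain component of the axiom for the multiplication and
    as the codomain component of the axiom for the comultiplication. The other components are monad
    and comonad laws, or facts about units. *)
Lemma free_distr :
  is_distributive_law (rho F) free_Sig (lam F) free_Pi law.
Proof.
  repeat split; intros f; apply sq_eq.
  - exact (free_delta_fL f).
  - exact (f_equal (fun t => sdom t) (proj1 (proj2 free_monad) f)).
  - exact (free_delta_mult f).
  - refine (eq_trans (f_equal (fun t => sdom t) (proj2 (proj2 free_monad) f)) _).
    refine (cmp_congl _ _).
    refine (eq_trans (eq_sym (cmp_idl _))
              (cmp_congl _ (eq_sym (free_mult_cod (L f))))).
  - exact (rho_free_delta f).
  - refine (eq_trans (eq_sym (sq_comm (free_mult f))) _).
    refine (eq_trans (cmp_congl _ (free_mult_cod f)) (cmp_idl _)).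
  - exact (eq_trans (free_delta_coassoc f) (eq_sym (cmp_idr _))).
  - exact (free_delta_mult f).
Qed.

Definition free_awfs : Awfs p :=
  {| awfs_lawfs := free_lawfs; Pi := free_Pi; Pi_cod := free_mult_cod;
     Pi_monad := free_monad; awfs_distr := free_distr |}.

(** * The comparison from the given lawfs to the free awfs *)

Definition inc (f : V p) : hom (fK A f) (fK F f) :=
  α f ∘ fmap (fK A) (lam F f).

Lemma inc_nat (f g : V p) (s : hom f g) :
  inc g ∘ fmap (fK A) s = fmap (fK F) s ∘ inc f.
Proof.
  unfold inc.
  rewrite (cmp_assoc (fmap (fK F) s)).
  refine (eq_trans _ (cmp_congl _ (eq_sym (R_mor s)))).
  rewrite <- !cmp_assoc, <- !fmap_cmp; apply f_equal, f_equal.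
  exact (nt_nat (lam F) s).
Qed.

(** With the next lemma: [inc f] is the filler of the given left map against the free algebra
    [R f]. *)
Lemma inc_fL (f : V p) : inc f ∘ fL A f = fL F f.
Proof.
  unfold inc; rewrite <- cmp_assoc, fL_nat, cmp_assoc, act_unit; apply cmp_idl.
Qed.

Lemma inc_fR (f : V p) : fR F f ∘ inc f = fR A f.
Proof.
  unfold inc; rewrite cmp_assoc.
  refine (eq_trans (cmp_congl _ (act_over (α f))) _).
  refine (eq_trans (eq_sym (fR_nat A (lam F f))) (cmp_idl _)).
Qed.

Definition inc_fact : FFactMor A F :=
  {| fmor := @Build_NatTrans _ _ (fK A) (fK F) inc inc_nat;
     fmor_L := inc_fL; fmor_R := inc_fR |}.

(** As [free_diag f] preserves actions, [free_delta f ∘ inc f] is the action of [RRL f] on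
    [RRL_unit f]. Unfolding that composite action brings out the given [delta]. *)
Lemma inc_comult (f : V p) :
  Sig (free_lawfs) f ∘ Lmor inc_fact f
  = fmap L (Lmor inc_fact f) ∘ Lmor inc_fact (Lfun A f) ∘ Sig A f.
Proof.
  apply sq_eq.
  - refine (eq_sym (eq_trans (cmp_congr _ (Sig_dom A f)) (cmp_idr _))).
  - change (free_delta f ∘ inc f
      = fmap (fK F) (Lmor inc_fact f) ∘ inc (Lfun A f) ∘ delta A f).
    transitivity (α (L f) ∘ fmap (fK A)
      (fmap R (Lmor inc_fact f) ∘ lam F (Lfun A f)) ∘ delta A f).
    2: { unfold inc; rewrite cmp_assoc, fmap_cmp, (cmp_assoc (α (L f))).
         apply (f_equal (fun z => z ∘ _ ∘ _)).
         exact (eq_sym (R_mor (Lmor inc_fact f))). }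
    unfold inc at 1; rewrite cmp_assoc.
    refine (eq_trans (cmp_congl _ (free_diag_mor f)) _).
    rewrite <- cmp_assoc, <- fmap_cmp.
    refine (eq_trans (f_equal (fun z => _ ∘ fmap (fK A) z)
      (ext_lam (RRL_act f) (RRL_unit f))) _).
    cbn [act RRL_act cmp_action].
    rewrite <- !cmp_assoc; apply f_equal.
    rewrite delta_nat, cmp_assoc, <- fmap_cmp.
    apply (f_equal (fun z => fmap (fK A) z ∘ _)), sq_eq.
    + refine (eq_trans (cmp_idl _) _).
      exact (eq_sym (eq_trans (fL_nat F (Lmor inc_fact f)) (cmp_idr _))).
    + refine (eq_trans _ (eq_sym (cmp_idr _))).
      (* The intermediate lift of the composite action, restricted along the unit, is [inc f]
         itself. *)
      change (cmp_mid (vertical_cmp (fR_vert F (L f)) (fR_vert F f)) eq_refl (α f)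
              ∘ fmap (fK A) (RRL_unit f) = inc f).
      unfold cmp_mid, inc; rewrite <- cmp_assoc, <- fmap_cmp.
      apply f_equal, f_equal, sq_eq; [exact (fRL F (L f)) | apply cmp_idl].
Qed.

Definition inc_lawfs : LawfsMor A free_awfs :=
  @Build_LawfsMor _ _ p A free_awfs inc_fact inc_comult.

(** * The isomorphism between the two categories of algebras *)

Definition alg_ext (x : PAlg (lam A)) : hom (R (palg_ob x)) (palg_ob x) :=
  ext (action_of_palg x) (idm (palg_ob x)).

Lemma alg_ext_mor (x : PAlg (lam A)) :
  act_mor (α (palg_ob x)) (action_of_palg x) (alg_ext x).
Proof. apply ext_mor. Qed.

Lemma alg_ext_unit (x : PAlg (lam A)) :
  alg_ext x ∘ lam F (palg_ob x) = idm (palg_ob x).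
Proof. exact (ext_lam _ _). Qed.

Definition palg_ext (x : PAlg (lam A)) : PAlg (lam F) :=
  {| palg_ob := palg_ob x; palg_act := alg_ext x;
     palg_unit := alg_ext_unit x |} : PAlgOb (lam F).

Lemma alg_ext_nat (x y : PAlg (lam A)) (s : hom x y) :
  palg_hom s ∘ alg_ext x = alg_ext y ∘ fmap R (palg_hom s).
Proof.
  apply (free_eq_lam (a := action_of_palg y)).
  - exact (act_mor_cmp (act_mor_of_palg s) (alg_ext_mor x)).
  - exact (act_mor_cmp (alg_ext_mor y) (R_mor _)).
  - rewrite <- !cmp_assoc, alg_ext_unit, cmp_idr.
    rewrite <- (nt_nat (lam F)), cmp_assoc, alg_ext_unit.
    symmetry; apply cmp_idl.
Qed.

Lemma alg_ext_assoc (x : PAlg (lam A)) :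
  alg_ext x ∘ fmap R (alg_ext x) = alg_ext x ∘ free_mult (palg_ob x).
Proof.
  apply (free_eq_lam (a := action_of_palg x)).
  - exact (act_mor_cmp (alg_ext_mor x) (R_mor _)).
  - exact (act_mor_cmp (alg_ext_mor x) (free_mult_mor _)).
  - rewrite <- !cmp_assoc, free_mult_unit, cmp_idr.
    rewrite <- (nt_nat (lam F)), cmp_assoc, alg_ext_unit.
    apply cmp_idl.
Qed.

Program Definition malg_ext : Functor (PAlg (lam A)) (MAlg (lam F) free_Pi) :=
  {| fob := fun x : PAlg (lam A) =>
       {| fs_ob := palg_ext x; fs_prop := alg_ext_assoc x |}
       : MAlg (lam F) free_Pi;
     fmap := fun x y s => @Build_PAlgHom _ _ (lam F) (palg_ext x) (palg_ext y)
       (palg_hom s) (alg_ext_nat s) |}.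
Next Obligation. now apply PAlgHom_eq. Qed.
Next Obligation. now apply PAlgHom_eq. Qed.

(** One round trip: [alg_ext x] preserves actions, so it slides past the action inside [inc] and
    cancels against the unit. *)
Lemma alg_ext_restrict (x : PAlg (lam A)) :
  alg_ext x ∘ Rmor inc_fact (palg_ob x) = palg_act x.
Proof.
  apply sq_eq.
  - change (sdom (alg_ext x) ∘ inc (palg_ob x) = sdom (palg_act x)).
    unfold inc; rewrite cmp_assoc.
    refine (eq_trans (cmp_congl _ (alg_ext_mor x)) _).
    rewrite <- cmp_assoc, <- fmap_cmp.
    refine (eq_trans (f_equal (fun z => _ ∘ fmap (fK A) z) (alg_ext_unit x)) _).
    rewrite fmap_id; apply cmp_idr.
  - refine (eq_trans (cmp_idr _) _); rewrite palg_act_cod; exact (ext_cod _ _).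
Qed.

Lemma free_mult_inc (g : V p) : sdom (free_mult g) ∘ inc (R g) = act (α g).
Proof.
  unfold inc; rewrite cmp_assoc.
  refine (eq_trans (cmp_congl _ (free_mult_mor g)) _).
  rewrite <- cmp_assoc, <- fmap_cmp.
  refine (eq_trans (f_equal (fun z => _ ∘ fmap (fK A) z) (free_mult_unit g)) _).
  rewrite fmap_id; apply cmp_idr.
Qed.

(** The other round trip. The monad action [be] is itself a morphism for the induced action, by its
    associativity law and [free_mult_inc], so freeness identifies it with the extension of the
    identity. *)
Lemma alg_ext_induced (x : MAlg (lam F) free_Pi) :
  alg_ext (ralg_induced inc_fact (fs_ob x)) = palg_act (fs_ob x).
Proof.
  set (be := palg_act (fs_ob x)); set (g := palg_ob (fs_ob x)) in *.
  apply (free_eq_lam (a := action_of_palg (ralg_induced inc_fact (fs_ob x)))).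
  - apply alg_ext_mor.
  - change (sdom be ∘ α g = sdom be ∘ inc g ∘ fmap (fK A) be).
    rewrite <- cmp_assoc, inc_nat, cmp_assoc.
    refine (eq_trans _ (cmp_congl _
      (eq_sym (f_equal (fun s => sdom s) (fs_prop x))))).
    change (sdom be ∘ α g = sdom be ∘ sdom (free_mult g) ∘ inc (R g)).
    rewrite <- cmp_assoc; apply f_equal; symmetry; exact (free_mult_inc g).
  - refine (eq_trans (alg_ext_unit (ralg_induced inc_fact (fs_ob x))) _).
    exact (eq_sym (palg_unit (fs_ob x))).
Qed.

Lemma free_awfs_algebraically_free : algebraically_free inc_lawfs.
Proof.
  exists malg_ext; split; apply functor_eq.
  - intros x y s; apply arr_eq_FullSub.
    apply (arr_eq_PAlg (x := fs_ob x) (y := fs_ob y) (f := s));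
      [exact (alg_ext_induced x) | exact (alg_ext_induced y) | reflexivity].
  - intros x y s.
    apply (arr_eq_PAlg (x := x) (y := y) (f := s));
      [exact (alg_ext_restrict x) | exact (alg_ext_restrict y) | reflexivity].
Qed.

End FreeAwfs.


Theorem theorem5p4p6 (E B : Category) (p : Functor E B) (cl : Cleavage p)
    (Hlim : has_all_finite_limits cl) (A1 : Lawfs p)
    (init : forall (X Y : E) (f : hom X Y) (vf : vertical p f),
      Initial (Comma (fibre_vert vf)
                 (fib_restrict (palg_forget (lam A1)) (cod_functor p) Y))) :
  exists (A : Awfs p) (m : LawfsMor A1 A), algebraically_free m.
Proof.
  assert (H : forall f : V p, inhabited (free_action A1 f)).
  { intros f; apply (free_action_of_initial Hlim).
    exact (init _ _ _ (fs_prop f : vertical p (vmap f))). }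
  (* The trivial predicate makes [epsilon] a plain choice of one free algebra for every [f] at
     once. *)
  pose (fr := fun f => epsilon (H f) (fun _ => True)).
  exists (free_awfs fr), (inc_lawfs fr); apply free_awfs_algebraically_free.
Qed.
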